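(* Let $\mathcal{G}$ be a Lie groupoid over $M$. Then $\mathcal{G}$ admits a strictly positive transverse density if and only if its modular class $\mathrm{mod}(\mathcal{G})\in H^1_{\mathrm{diff}}(\mathcal{G})$ vanishes.
   Context: Conventions. $\mathcal{G}$ is a Lie groupoid over $M$ with source $s$ and target $t$, all of whose $s$-fibers have the same dimension; $g:x\to y$ means $s(g)=x$, $t(g)=y$. $A=\ker(ds)|_M$ is its Lie algebroid (a vector bundle of constant rank). Densities. For an $r$-dimensional real vector space $V$ with space of frames $\mathrm{Fr}(V)=\mathrm{Isom}(\mathbb{R}^r,V)$, the space of densities is the 1-dimensional space $\mathcal{D}_V=\mathcal{D}(V)=\{\xi:\mathrm{Fr}(V)\to\mathbb{R} : \xi(e\cdot B)=|\det B|\,\xi(e)\ \forall e\in \mathrm{Fr}(V), B\in GL_r\}$. An element is strictly positive if it takes positive values on all frames. There are canonical isomorphisms, preserving positivity: $\mathcal{D}_{V^*}\cong\mathcal{D}_V^*$ (the pairing of $\xi\in \mathcal{D}_V$ and $\eta\in\mathcal{D}_{V^*}$ is $\xi(e)\eta(e^* )$, with $e^*$ the frame dual to $e$), and $\mathcal{D}_V\otimes\mathcal{D}_W\cong\mathcal{D}_U$ for any exact sequence $0\to V\to U\to W\to 0$ ($\xi\otimes\eta\mapsto\zeta$ with $\zeta(e_V,\tilde e_W)=\xi(e_V)\eta(e_W)$, where $\tilde e_W$ is a lift of $e_W$ to $U$). For vector bundles, apply these constructions fiberwise. Transverse density bundle. $\mathcal{D}_A^{\mathrm{tr}}=\mathcal{D}_{A^*}\otimes\mathcal{D}_{TM}$,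 a line bundle over $M$; strictly positive elements are the tensor products of strictly positive ones. $\mathcal{G}$ acts on it as follows. For $g:x\to y$, right translation and $ds$ give an exact sequence $0\to A_y\to T_g\mathcal{G}\xrightarrow{ds}T_xM\to0$, hence $\mathcal{D}(T_g\mathcal{G})\cong\mathcal{D}(A_y)\otimes\mathcal{D}(T_xM)$. Using the same isomorphism at $g^{-1}$ and the isomorphism $T_g\mathcal{G}\cong T_{g^{-1}}\mathcal{G}$ given by the differential of inversion, one gets $\mathcal{D}(A_y)\otimes\mathcal{D}(T_xM)\cong\mathcal{D}(A_x)\otimes\mathcal{D}(T_yM)$, and hence an isomorphism $g_*:\mathcal{D}(A_x^* )\otimes\mathcal{D}(T_xM)\to\mathcal{D}(A_y^* )\otimes\mathcal{D}(T_yM)$. This is the action of $g$. A transverse density for $\mathcal{G}$ is a (smooth) $\mathcal{G}$-invariant section $\sigma$ of $\mathcal{D}_A^{\mathrm{tr}}$, i.e. $g_*\sigma(x)=\sigma(y)$ for all $g:x\to y$. Modular class. $H^1_{\mathrm{diff}}(\mathcal{G})$ is the space of smooth $c:\mathcal{G}\to\mathbb{R}$ with $c(gh)=c(g)+c(h)$ for composable $g,h$, modulo the functions $\delta(f)(g)=f(s(g))-f(t(g))$, $f\in C^\infty(M)$. For any strictly positive section $\sigma$ of $\mathcal{D}_A^{\mathrm{tr}}$ (one always exists), put $c_\sigma(g)=\ln\left(\frac{\sigma(y)}{g_*\sigma(x)}\right)$ for $g:x\to y$. This is a 1-cocycle whose class is independent of $\sigma$, and $\mathrm{mod}(\mathcal{G}):=[c_\sigma]\in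 H^1_{\mathrm{diff}}(\mathcal{G})$. *)

(* Defs.v *)
From HB Require Import structures.
From mathcomp Require Import all_boot all_order all_algebra.
From mathcomp Require Import all_classical all_reals all_analysis.

Set Implicit Arguments.
Unset Strict Implicit.
Unset Printing Implicit Defensive.

Import Order.TTheory GRing.Theory Num.Theory.
Import numFieldNormedType.Exports.

Local Open Scope classical_set_scope.
Local Open Scope ring_scope.

(* C^k and C^infinity maps on an open subset U of a finite-dimensional space *)

Fixpoint Ck (R : realType) (V W : normedModType R) (k : nat)
    (U : set V) (f : V -> W) : Prop :=
  match k with
  | 0 => forall x, U x -> {for x, continuous f}
  | k'.+1 => (forall x, U x -> differentiable f x) /\
             (forall v : V, Ck k' U (fun x => 'D_v f x))
  end.

Definition smooth_on (R : realType) (V W : normedModType R)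
    (U : set V) (f : V -> W) : Prop := forall k, Ck k U f.

(* n-dimensional smooth manifolds, given by an atlas [chart].  [chart_inv phi]
   is the inverse of the coordinate map [chart_map phi] on the image of
   [chart_dom phi].  No separation or countability axiom is included here. *)

Record manifold (R : realType) (n : nat) := Manifold {
  pts :> topologicalType;
  chart : Type;
  chart_dom : chart -> set pts;
  chart_map : chart -> pts -> 'rV[R]_n;
  chart_inv : chart -> 'rV[R]_n -> pts;
  chart_dom_open : forall phi, open (chart_dom phi);
  chart_img_open : forall phi, open (chart_map phi @` chart_dom phi);
  chart_mapK : forall phi x, chart_dom phi x ->
    chart_inv phi (chart_map phi x) = x;
  chart_map_continuous : forall phi x, chart_dom phi x ->
    {for x, continuous (chart_map phi)};
  chart_inv_continuous : forall phi p, (chart_map phi @` chart_dom phi) p ->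
    {for p, continuous (chart_inv phi)};
  chart_cover : forall x, exists phi, chart_dom phi x;
  chart_transition_smooth : forall phi psi,
    smooth_on (chart_map phi @` (chart_dom phi `&` chart_dom psi))
      (chart_map psi \o chart_inv phi)
}.

Section SmoothMaps.
Variable R : realType.

Definition smooth_map m n (M : manifold R m) (N : manifold R n)
    (f : M -> N) : Prop :=
  continuous f /\
  forall (phi : chart M) (psi : chart N),
    smooth_on (chart_map phi @` (chart_dom phi `&` f @^-1` chart_dom psi))
              (chart_map psi \o f \o chart_inv phi).

Definition smooth_fun n (M : manifold R n) (U : set M) (f : M -> R) : Prop :=
  forall phi : chart M,
    smooth_on (chart_map phi @` (chart_dom phi `&` U))
              (f \o chart_inv phi : _ -> R^o).

(* The tangent space T_xM is modelled by 'rV_n: a vector stands for the tangent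
   vector having these components in the preferred chart [chart_at x]. *)

Definition chart_at n (M : manifold R n) (x : M) : chart M :=
  projT1 (cid (chart_cover x)).

Definition tangent_map m n (M : manifold R m) (N : manifold R n)
    (f : M -> N) (x : M) : 'Hom('rV[R]_m, 'rV[R]_n) :=
  linfun ('d (chart_map (chart_at (f x)) \o f \o chart_inv (chart_at x))
             (chart_map (chart_at x) x)).

(* components in the chart psi of the vector v of T_yN *)
Definition components n (N : manifold R n) (psi : chart N) (y : N)
    (v : 'rV[R]_n) : 'rV[R]_n :=
  'd (chart_map psi \o chart_inv (chart_at y)) (chart_map (chart_at y) y) v.

(* X x in T_(h x)N depends smoothly on x in the open set U *)
Definition smooth_field_along m n (M : manifold R m) (N : manifold R n)
    (h : M -> N) (U : set M) (X : M -> 'rV[R]_n) : Prop :=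
  forall (phi : chart M) (psi : chart N),
    smooth_on (chart_map phi @` (chart_dom phi `&` U `&` h @^-1` chart_dom psi))
      (fun p => components psi (h (chart_inv phi p)) (X (chart_inv phi p))).

Definition submersion m n (M : manifold R m) (N : manifold R n)
    (f : M -> N) : Prop :=
  smooth_map f /\ forall x, limg (tangent_map f x) = fullv.

Definition differentiable_curve n (N : manifold R n) (c : R -> N) : Prop :=
  {for 0, continuous c} /\
  derivable (chart_map (chart_at (c 0)) \o c : R^o -> 'rV[R]_n) 0 1.

Definition velocity n (N : manifold R n) (c : R -> N) : 'rV[R]_n :=
  'D_1 (chart_map (chart_at (c 0)) \o c : R^o -> 'rV[R]_n) 0.

End SmoothMaps.

(* Lie groupoids over an n-manifold whose s-fibers all have dimension r.  The
   multiplication [gmul g h] ("g after h") is a total function, meaningful only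
   when s g = t h.  The space of arrows need not be Hausdorff. *)

Record lie_groupoid (R : realType) (n r : nat) := LieGroupoid {
  obj : manifold R n;
  arr : manifold R (r + n);
  src : arr -> obj;
  tgt : arr -> obj;
  gunit : obj -> arr;
  ginv : arr -> arr;
  gmul : arr -> arr -> arr;
  src_gunit : forall x, src (gunit x) = x;
  tgt_gunit : forall x, tgt (gunit x) = x;
  src_ginv : forall g, src (ginv g) = tgt g;
  tgt_ginv : forall g, tgt (ginv g) = src g;
  src_gmul : forall g h, src g = tgt h -> src (gmul g h) = src h;
  tgt_gmul : forall g h, src g = tgt h -> tgt (gmul g h) = tgt g;
  gmulA : forall g h k, src g = tgt h -> src h = tgt k ->
    gmul g (gmul h k) = gmul (gmul g h) k;
  gmul1l : forall g, gmul (gunit (tgt g)) g = g;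
  gmul1r : forall g, gmul g (gunit (src g)) = g;
  gmulVl : forall g, gmul (ginv g) g = gunit (src g);
  gmulVr : forall g, gmul g (ginv g) = gunit (tgt g);
  obj_hausdorff : hausdorff_space obj;
  obj_second_countable : @second_countable obj;
  src_submersion : submersion src;
  tgt_submersion : submersion tgt;
  gunit_smooth : smooth_map gunit;
  ginv_smooth : smooth_map ginv;
  (* [gmul] is smooth on the embedded submanifold {(g, h) | s g = t h} of the
     product, i.e. in charts it extends locally to a smooth map F *)
  gmul_smooth : forall (g h : arr) (phi psi chi : chart arr),
    src g = tgt h -> chart_dom phi g -> chart_dom psi h ->
    chart_dom chi (gmul g h) ->
    exists (W : set ('rV[R]_(r + n) * 'rV[R]_(r + n)))
           (F : 'rV[R]_(r + n) * 'rV[R]_(r + n) -> 'rV[R]_(r + n)),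
      [/\ open W, W (chart_map phi g, chart_map psi h), smooth_on W F &
        forall g' h', chart_dom phi g' -> chart_dom psi h' ->
          W (chart_map phi g', chart_map psi h') -> src g' = tgt h' ->
          chart_dom chi (gmul g' h') /\
          chart_map chi (gmul g' h') = F (chart_map phi g', chart_map psi h')]
}.

(* Densities.  A function on Fr(V) is represented by its extension by 0 to all
   r-tuples of vectors. *)

Section Densities.
Variable R : realType.

(* e . B *)
Definition frame_mul r (V : vectType R) (e : r.-tuple V) (B : 'M[R]_r) :
    r.-tuple V :=
  [tuple \sum_(i < r) B i j *: tnth e i | j < r].

Definition densities r (V : vectType R) : set (r.-tuple V -> R) :=
  [set xi : r.-tuple V -> R |
     (forall e : r.-tuple V, ~~ basis_of fullv e -> xi e = 0) /\
     (forall (e : r.-tuple V) (B : 'M[R]_r), basis_of fullv e ->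
        B \in unitmx -> xi (frame_mul e B) = `|\det B| * xi e)].

Definition positive_density r (V : vectType R) (xi : r.-tuple V -> R) : Prop :=
  densities xi /\ forall e : r.-tuple V, basis_of fullv e -> 0 < xi e.

(* e^*, the frame of V^* = 'Hom(V, R^o) dual to e *)
Definition dual_frame r (V : vectType R) (e : r.-tuple V) :
    r.-tuple 'Hom(V, R^o) :=
  [tuple linfun (coord e i : V -> R^o) | i < r].

(* Tensor products of spaces of functions P on X and Q on Y: P (x) Q
   embeds in the functions on X * Y, as the span of the pure tensors. *)

Definition pure_tensor (X Y : Type) (xi : X -> R) (eta : Y -> R) : X * Y -> R :=
  fun p => xi p.1 * eta p.2.

Definition tensor (X Y : Type) (P : set (X -> R)) (Q : set (Y -> R)) :
    set (X * Y -> R) :=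
  [set z | exists (k : nat) (xi : 'I_k -> X -> R) (eta : 'I_k -> Y -> R),
     (forall i, P (xi i) /\ Q (eta i)) /\
     z = \sum_(i < k) pure_tensor (xi i) (eta i)].

(* The canonical isomorphism D_V (x) D_W -> D_U of an exact sequence
   0 -> V -i-> U -p-> W -> 0. *)
Definition density_exact a b (V U W : vectType R) (i : 'Hom(V, U))
    (p : 'Hom(U, W)) (z : a.-tuple V * b.-tuple W -> R) :
    (a + b).-tuple U -> R :=
  xget 0 [set zeta | densities zeta /\
    forall (e : a.-tuple V) (f : b.-tuple U),
      basis_of fullv e -> basis_of fullv (map_tuple p f) ->
      zeta (cat_tuple (map_tuple i e) f) = z (e, map_tuple p f)].

(* the isomorphism D_U' -> D_U induced by an isomorphism h : U -> U' *)
Definition density_pullback r (U U' : vectType R) (h : 'Hom(U, U'))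
    (zeta : r.-tuple U' -> R) : r.-tuple U -> R :=
  fun e => zeta (map_tuple h e).

(* the quotient z / z' of two elements of a line *)
Definition line_ratio (X : Type) (z z' : X -> R) : R :=
  xget 0 [set c : R | z = c *: z'].

End Densities.

Section TransverseDensities.
Variables (R : realType) (n r : nat) (G : lie_groupoid R n r).
Local Notation M := (obj G).
Local Notation "'T_M'" := 'rV[R]_n.
Local Notation "'T_G'" := 'rV[R]_(r + n).

Definition algebroid (x : M) : {vspace T_G} :=
  lker (tangent_map (@src _ _ _ G) (gunit x)).

Local Notation A x := (subvs_of (algebroid x)).

(* For g : x -> y, the differential A_y -> T_gG of the right translation
   h |-> h g, a map s^-1(y) -> s^-1(x), at h = 1_y. *)
Definition right_translation (y : M) (g : arr G) : 'Hom(A y, T_G) :=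
  xget 0 [set L : 'Hom(A y, T_G) |
    forall c : R -> arr G, c 0 = gunit y -> (forall u, src (c u) = y) ->
      differentiable_curve c ->
      forall a : A y, vsval a = velocity c ->
        L a = velocity (fun u => gmul (c u) g)].

(* D(A_y) (x) D(T_xM) -> D(T_gG), for g : x -> y; the target y is a separate
   argument so that the target of g^-1 can be given as the source of g *)
Definition density_arrow (y : M) (g : arr G)
    (z : r.-tuple (A y) * n.-tuple T_M -> R) : (r + n).-tuple T_G -> R :=
  density_exact (right_translation y g) (tangent_map (@src _ _ _ G) g) z.

(* D(A_y) (x) D(T_xM) -> D(A_x) (x) D(T_yM), for g : x -> y *)
Definition density_swap (g : arr G)
    (z : r.-tuple (A (tgt g)) * n.-tuple T_M -> R) :
    r.-tuple (A (src g)) * n.-tuple T_M -> R :=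
  xget 0 [set z' |
    tensor (@densities R r (A (src g))) (@densities R n T_M) z' /\
    density_pullback (tangent_map (@ginv _ _ _ G) g)
                     (density_arrow (ginv g) z')
    = density_arrow g z].

Definition transverse_fiber (x : M) : Type :=
  r.-tuple 'Hom(A x, R^o) * n.-tuple T_M -> R.

Definition transverse_line (x : M) : set (transverse_fiber x) :=
  tensor (@densities R r 'Hom(A x, R^o)) (@densities R n T_M).

Definition positive_transverse (x : M) (z : transverse_fiber x) : Prop :=
  exists (eta : r.-tuple 'Hom(A x, R^o) -> R) (kappa : n.-tuple T_M -> R),
    [/\ positive_density eta, positive_density kappa &
        z = pure_tensor eta kappa].

(* The action g_* : D(A_x^* ) (x) D(T_xM) -> D(A_y^* ) (x) D(T_yM), for
   g : x -> y.  Write an element as eta (x) kappa.  Under D(A^* ) = D(A)^*, its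
   image tau is determined by <xi, tau> = <eta, density_swap (xi (x) kappa)>
   for all xi in D(A_y); the pairing of xi' in D(A) and eta' in D(A^* ) is
   xi'(e) eta'(e^* ), for any frame e. *)
Definition arrow_action (g : arr G) (z : transverse_fiber (src g)) :
    transverse_fiber (tgt g) :=
  xget (fun=> 0) [set tau : transverse_fiber (tgt g) |
    transverse_line tau /\
    forall (eta : r.-tuple 'Hom(A (src g), R^o) -> R)
           (kappa : n.-tuple T_M -> R)
           (xi : r.-tuple (A (tgt g)) -> R),
      densities eta -> densities kappa -> densities xi ->
      z = pure_tensor eta kappa ->
      forall (a : r.-tuple (A (tgt g))) (b : r.-tuple (A (src g)))
             (f : n.-tuple T_M),
        basis_of fullv a -> basis_of fullv b -> basis_of fullv f ->
        xi a * tau (dual_frame a, f) =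
        eta (dual_frame b) * density_swap (pure_tensor xi kappa) (b, f)].

(* Smoothness is tested on all smooth local frames of A (giving the dual frames
   of A^* ) and of TM. *)
Definition transverse_section (sigma : forall x, transverse_fiber x) : Prop :=
  (forall x, transverse_line (sigma x)) /\
  forall (U : set M) (a : forall x, r.-tuple (A x)) (f : M -> n.-tuple T_M),
    open U ->
    (forall x, U x -> basis_of fullv (a x) /\ basis_of fullv (f x)) ->
    (forall j, smooth_field_along (@gunit _ _ _ G) U
                 (fun x => vsval (tnth (a x) j))) ->
    (forall j, smooth_field_along (fun x : M => x) U
                 (fun x => tnth (f x) j)) ->
    smooth_fun U (fun x => sigma x (dual_frame (a x), f x)).

Definition positive_section (sigma : forall x, transverse_fiber x) : Prop :=
  transverse_section sigma /\ forall x, positive_transverse (sigma x).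

Definition transverse_density (sigma : forall x, transverse_fiber x) : Prop :=
  transverse_section sigma /\
  forall g : arr G, arrow_action (sigma (src g)) = sigma (tgt g).

Definition cocycles : set (arr G -> R) :=
  [set c | smooth_fun setT c /\
           forall g h, src g = tgt h -> c (gmul g h) = c g + c h].

Definition coboundary (f : M -> R) : arr G -> R :=
  fun g => f (src g) - f (tgt g).

(* The class of c in H^1_diff(G), as a subset of the space of cocycles *)
Definition cohomology_class (c : arr G -> R) : set (arr G -> R) :=
  [set c' | cocycles c' /\
     exists2 f : M -> R, smooth_fun setT f & c' = c + coboundary f].

Definition modular_cocycle (sigma : forall x, transverse_fiber x) :
    arr G -> R :=
  fun g => ln (line_ratio (sigma (tgt g)) (arrow_action (sigma (src g)))).

(* The class of modular_cocycle sigma, for any strictly positive section sigma;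
   one always exists.  The default set0 is not a cohomology class. *)
Definition modular_class : set (arr G -> R) :=
  xget set0 [set K | exists2 sigma, positive_section sigma &
                       K = cohomology_class (modular_cocycle sigma)].

End TransverseDensities.

Arguments modular_class {R n r} G.
Arguments cohomology_class {R n r} G c.

(* Main.v *)
Require Import Defs.
From HB Require Import structures.
From mathcomp Require Import all_boot all_order all_algebra.
From mathcomp Require Import all_classical all_reals all_analysis.
From mathcomp Require Import ring lra.

Set Implicit Arguments.
Unset Strict Implicit.
Unset Printing Implicit Defensive.

Import Order.TTheory GRing.Theory Num.Theory.
Import numFieldNormedType.Exports.

Local Open Scope classical_set_scope.
Local Open Scope ring_scope.

(** If [sigma] is a positive section and [f] a smooth function, then replacing
    [sigma] by [exp f sigma] changes its cocycle by a coboundary, because the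
    action is linear on lines; and the cocycle of [sigma] vanishes exactly if
    [sigma] is invariant. Given an invariant positive [sigma], any other positive
    section is [exp h sigma] for the function [h], the logarithm of their ratio,
    and so has the cocycle [h o tgt - h o src], a coboundary. Given a vanishing
    modular class, some positive [sigma] has the cocycle [f o tgt - f o src], and
    [exp (- f) sigma] is invariant.

    Two facts need work. First, [h] is smooth ([smooth_ln_ratio]). A ratio of
    sections can be computed in any frames, and smooth local frames exist: on
    the base by charts, and for the algebroid by projecting a frame that is
    constant in a chart to the kernel of the tangent map of the source along the
    units ([algebroid_local_frame]).

    Second, the action maps positive elements to positive elements
    ([arrow_actionE]), so that the logarithm in the cocycle is the logarithm of
    a positive number. For this, each isomorphism in the definition of the action
    must be determined by its defining property. Densities form a line, and in
    adapted frames the isomorphisms of exact sequences and of dual spaces are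
    multiplications by positive determinants ([vol_exact], [vol_dual]), provided
    that right translation and the tangent map of the source form an exact
    sequence. Right translation is defined through velocities of curves in source
    fibres. It is determined on the whole algebroid because every vector in the
    kernel of the tangent map of a submersion is the velocity of a curve in the
    fibre ([submersion_curve]), a form of the implicit function theorem proved by
    a contraction ([fibre_curve]). It is injective because translation by the
    inverse arrow undoes it, and a count of dimensions gives exactness. *)

(** * Calculus of C^k maps *)

Section CkCalculus.
Variable R : realType.
Implicit Types V W : normedModType R.

Lemma diff_little V W (f : V -> W) x : differentiable f x ->
  forall e : R, 0 < e ->
    \forall h \near (0 : V), `|f (h + x) - f x - 'd f x h| <= e * `|h|.
Proof.
move=> /diff_locally/eqaddoP fd e e0; have := fd _ e0.
by apply: filterS => h; rewrite /= opprD addrA.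
Qed.

(** The differential as the unique linear map with a small remainder: this is
    how a differential is computed below. *)
Lemma diff_intro V W (f : V -> W) (x : V) (L : {linear V -> W}) :
  continuous L ->
  (forall e : R, 0 < e ->
    \forall h \near (0 : V), `|f (h + x) - f x - L h| <= e * `|h|) ->
  differentiable f x /\ 'd f x = L :> (V -> W).
Proof.
move=> cL Lf.
have ef : f \o shift x = cst (f x) + L +o_ (0 : V) id.
  apply/eqaddoP => e e0; apply: filterS (Lf _ e0) => h /=.
  by rewrite opprD addrA.
have dE := diff_unique cL ef.
by split => //; apply/diff_locallyP; rewrite dE.
Qed.

(** Differentials are local. Coordinate expressions of one map in different
    charts only agree near a point, so this is used at every change of chart. *)
Lemma near_eq_diff V W (f g : V -> W) x : (\near x, f x = g x) ->
  differentiable f x -> differentiable g x /\ 'd g x = 'd f x :> (V -> W).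
Proof.
move=> fg df; apply: diff_intro => [|e e0]; first exact: diff_continuous.
have fg0 : \forall h \near (0 : V), f (h + x) = g (h + x).
  by move: fg; rewrite (near_shift 0 x) /= subr0.
have fgx : f x = g x := nbhs_singleton fg.
near=> h; rewrite -fgx; have <- : f (h + x) = g (h + x) by near: h.
by near: h; exact: diff_little.
Unshelve. all: by end_near. Qed.

(** The chain rule for coordinate expressions: [k] is the composite read in
    charts and need only agree with [g o f] near [x]. *)
Lemma diff_chain (V1 V2 V3 : normedModType R) (f : V1 -> V2) (g : V2 -> V3)
    (k : V1 -> V3) x y v :
  differentiable f x -> f x = y -> differentiable g y ->
  (\near x, g (f x) = k x) -> 'd g y ('d f x v) = 'd k x v.
Proof.
move=> df <- dg gfk.
have dgf : differentiable (g \o f) x by exact: differentiable_comp.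
have [_ kE] := near_eq_diff gfk dgf.
by rewrite kE (diff_comp df dg).
Qed.

Lemma Ck_sub V W k (U U' : set V) (f : V -> W) :
  U' `<=` U -> Ck k U f -> Ck k U' f.
Proof.
elim: k f => [|k IH] f UU' /=; first by move=> cf x /UU'/cf.
by move=> [df Df]; split => [x /UU'/df//|v]; apply: IH.
Qed.

Lemma Ck_local V W k (U : set V) (f : V -> W) :
  (forall x, U x -> exists2 U', U' x & Ck k U' f) -> Ck k U f.
Proof.
elim: k f => [|k IH] f /= H.
  by move=> x /H[U' U'x]; apply.
split=> [x /H[U' U'x [df _]]|v]; first exact: df.
by apply: IH => x /H[U' U'x [_ Df]]; exists U'.
Qed.

Lemma Ck_eq V W k (U : set V) (f g : V -> W) :
  open U -> (forall x, U x -> f x = g x) -> Ck k U f -> Ck k U g.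
Proof.
move=> oU; have nU (u v : V -> W) x : U x -> (forall y, U y -> u y = v y) ->
    \near x, u x = v x.
  by move=> Ux uv; move: (open_nbhs_nbhs (conj oU Ux)); apply: filterS.
elim: k f g => [|k IH] f g fg /=.
  move=> cf x Ux; suff: g @ x --> f x by rewrite fg.
  by apply: cvg_trans (cf x Ux); apply: near_eq_cvg; apply: nU.
move=> [df Df]; split=> [x Ux|v].
  by have [] := near_eq_diff (nU _ _ _ Ux fg) (df x Ux).
by apply: IH (Df v) => x Ux; apply: near_eq_derive; apply: nU.
Qed.

Lemma Ck_pred V W k (U : set V) (f : V -> W) : Ck k.+1 U f -> Ck k U f.
Proof.
elim: k f => [|k IH] f; first by move=> [df _] x /df/differentiable_continuous.
by move=> [df Df]; split=> // v; apply: IH.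
Qed.

Lemma Ck_cst V W k (U : set V) (c : W) : Ck k U (fun=> c).
Proof.
elim: k c => [|k IH] c /=; first by move=> x _; exact: cst_continuous.
split => [x _|v]; first exact: differentiable_cst.
under eq_fun do rewrite derive_cst.
exact: IH.
Qed.

Lemma Ck_lin V W k (U : set V) (L : {linear V -> W}) :
  continuous L -> Ck k U L.
Proof.
move=> cL; case: k => [|k] /=; first by move=> x _; exact: cL.
have dL x : differentiable L x by exact: linear_differentiable.
split => // v.
have -> : (fun x => 'D_v L x) = (fun=> L v).
  by apply/funext => x; rewrite deriveE// diff_lin.
exact: Ck_cst.
Qed.

Lemma Ck_comp_lin V W (W' : normedModType R) k (U : set V) (f : V -> W)
  (L : {linear W -> W'}) : open U ->
  continuous L -> Ck k U f -> Ck k U (L \o f).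
Proof.
move=> oU cL; elim: k f => [|k IH] f /=.
  by move=> cf x Ux; apply: continuous_comp; [exact: cf|exact: cL].
move=> [df Df]; split => [x Ux|v].
  by apply: differentiable_comp; [exact: df|exact: linear_differentiable].
apply: Ck_eq (IH _ (Df v)) => // x Ux /=.
have dL := linear_differentiable (f x) cL.
have dfx := df x Ux.
have dc : differentiable (L \o f) x by exact: differentiable_comp.
rewrite (deriveE v dfx) (deriveE v dc).
by rewrite (diff_comp dfx dL) (diff_lin (f x) cL).
Qed.

Lemma CkD V W k (U : set V) (f g : V -> W) : open U ->
  Ck k U f -> Ck k U g -> Ck k U (fun x => f x + g x).
Proof.
move=> oU; elim: k f g => [|k IH] f g /=.
  by move=> cf cg x Ux; apply: continuousD; [exact: cf|exact: cg].
move=> [df Df] [dg Dg]; split => [x Ux|v].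
  by apply: differentiableD; [exact: df|exact: dg].
apply: Ck_eq (IH _ _ (Df v) (Dg v)) => // x Ux /=.
rewrite (@deriveD _ _ _ f g) //; apply: diff_derivable.
  exact: df.
exact: dg.
Qed.

Lemma Ck_sum V W k (U : set V) m (f : 'I_m -> V -> W) : open U ->
  (forall i, Ck k U (f i)) -> Ck k U (fun x => \sum_(i < m) f i x).
Proof.
move=> oU Cf.
suff H (s : seq 'I_m) : Ck k U (fun x => \sum_(i <- s) f i x) by exact: H.
elim: s => [|i s IH].
  by under eq_fun do rewrite big_nil; exact: Ck_cst.
by under eq_fun do rewrite big_cons; exact: CkD.
Qed.

Lemma scale_is_bilinear W : bilinear_for
  (GRing.Scale.Law.clone _ _ *:%R _) (GRing.Scale.Law.clone _ _ *:%R _)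
  (@GRing.scale R W : R^o -> W -> W).
Proof.
split=> [u'|u] a x y /=; first by rewrite scalerDl -scalerA.
by rewrite scalerDr !scalerA mulrC.
Qed.

HB.instance Definition _ W :=
  bilinear_isBilinear.Build R R^o W W _ _ (@GRing.scale R W : R^o -> W -> W)
    (@scale_is_bilinear W).

(** The product rule [D_v (c f) = (D_v c) f + c (D_v f)] expresses the
    derivatives of a product by products of one degree of smoothness less;
    this feeds the induction, here and in the next lemmas. *)
Lemma CkZ V W k (U : set V) (c : V -> R^o) (f : V -> W) : open U ->
  Ck k U c -> Ck k U f -> Ck k U (fun x => c x *: f x).
Proof.
move=> oU; elim: k c f => [|k IH] c f /=.
  by move=> cc cf x Ux; apply: continuousZ; [exact: cc|exact: cf].
move=> Cc Cf; have [[dc Dc] [df Df]] := (Cc, Cf).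
have dcf x : U x ->
    differentiable (fun x => c x *: f x) x /\
    forall v, 'D_v (fun x => c x *: f x) x = 'D_v c x *: f x + c x *: 'D_v f x.
  move=> Ux; have dcx := dc x Ux; have dfx := df x Ux.
  have dp := differentiable_pair dcx dfx.
  pose sc : {bilinear R^o -> W -> W} := (@GRing.scale R W : R^o -> W -> W).
  have db := @differentiable_bilin _ _ _ _ sc (c x, f x)
    (@scale_continuous _ W).
  have E : (fun x => c x *: f x) =
           (fun p : R^o * W => p.1 *: p.2) \o (fun x => (c x, f x)) by [].
  have dd : differentiable (fun x => c x *: f x) x.
    by rewrite E; exact: (@differentiable_comp _ _ _ _ _ _ _ dp db).
  split => // v; rewrite (deriveE v dcx) (deriveE v dfx) (deriveE v dd) E.
  rewrite (diff_comp dp db).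
  rewrite (@diff_bilin _ _ _ _ sc (c x, f x) (@scale_continuous _ W)).
  by rewrite (diff_pair dcx dfx) /sc /= addrC.
split => [x /dcf[]//|v].
apply: (@Ck_eq _ _ _ _ (fun x => 'D_v c x *: f x + c x *: 'D_v f x)) => //.
  by move=> x /dcf[_ ->].
by apply: CkD => //; apply: IH => //; exact: Ck_pred.
Qed.

Lemma coord_cont m (i : 'I_m) :
  continuous (fun v : 'rV[R]_m => v 0 i : R^o).
Proof. exact: coord_continuous. Qed.

Definition coord_lin m (i : 'I_m) (v : 'rV[R]_m) : R^o := v 0 i.

Lemma coord_lin_is_linear m (i : 'I_m) : linear (@coord_lin m i).
Proof. by move=> a u v; rewrite /coord_lin !mxE. Qed.

HB.instance Definition _ m (i : 'I_m) :=
  GRing.isLinear.Build R 'rV[R]_m R^o _ (@coord_lin m i)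
    (@coord_lin_is_linear m i).

Lemma Ck_coord V m k (U : set V) (f : V -> 'rV[R]_m) i : open U ->
  Ck k U f -> Ck k U (fun x => f x 0 i : R^o).
Proof.
move=> oU Cf; apply: (@Ck_comp_lin _ _ _ _ _ _ (@coord_lin m i)) => //.
exact: coord_cont.
Qed.

Lemma diff_rV V m (f : 'rV[R]_m -> V) x v :
  'd f x v = \sum_(i < m) v 0 i *: 'd f x (delta_mx 0 i).
Proof.
rewrite {1}[v]row_sum_delta linear_sum; apply: eq_bigr => i _.
by rewrite linearZ.
Qed.

(** The chain rule writes [D_v (f o g)] as the sum over [i] of
    [(D_v g)_i] times [(D_i f) o g], which are [C^k] when [f], [g] are
    [C^(k+1)]. *)
Lemma Ck_comp V W m k (U : set V) (U' : set 'rV[R]_m)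
    (g : V -> 'rV[R]_m) (f : 'rV[R]_m -> W) : open U ->
  (forall x, U x -> U' (g x)) -> Ck k U g -> Ck k U' f -> Ck k U (f \o g).
Proof.
move=> oU gU; elim: k f => [|k IH] f /=.
  move=> cg cf x Ux.
  by apply: continuous_comp; [exact: cg|apply: cf; exact: gU].
move=> Cg Cf; have [[dg Dg] [df Df]] := (Cg, Cf).
split => [x Ux|v].
  by apply: differentiable_comp; [exact: dg|apply: df; exact: gU].
apply: (@Ck_eq _ _ _ _
  (fun x => \sum_(i < m) ('D_v g x) 0 i *: 'D_(delta_mx 0 i) f (g x))) => //.
  move=> x Ux; have [dgx dfx] := (dg x Ux, df _ (gU _ Ux)).
  have dfg : differentiable (f \o g) x by exact: differentiable_comp.
  rewrite (deriveE v dfg) (diff_comp dgx dfx) [RHS]/= diff_rV.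
  by apply: eq_bigr => i _; rewrite (deriveE v dgx) (deriveE _ dfx).
apply: Ck_sum => // i; apply: CkZ => //; first exact: Ck_coord.
by apply: (IH ('D_(delta_mx 0 i) f)) => //; exact: Ck_pred.
Qed.

(** Composition with a function of one real variable. The derivative [h']
    composed with [c] is only needed one degree of smoothness lower, so that
    for [exp] and the inverse, whose derivatives are expressions in the functions
    themselves, the lemma feeds an induction on [k]. *)
Lemma Ck_comp1 V k (U : set V) (I : set R) (c : V -> R^o) (h h' : R -> R^o) :
  open U -> (forall x, U x -> I (c x)) ->
  (forall x, I x -> is_derive x 1 h (h' x)) ->
  Ck k U c -> (forall j, k = j.+1 -> Ck j U (h' \o c)) -> Ck k U (h \o c).
Proof.
move=> oU cI hh'; have dh x : I x -> differentiable h x.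
  by move=> /hh'[/derivable1_diffP].
case: k => [|k] /=.
  move=> cc _ x Ux; apply: continuous_comp; first exact: cc.
  by apply: differentiable_continuous; apply: dh; exact: cI.
move=> [dc Dc] /(_ _ erefl) Ch; split => [x Ux|v].
  by apply: differentiable_comp; [exact: dc|apply: dh; exact: cI].
apply: (@Ck_eq _ _ _ _ (fun x => 'D_v c x *: (h' \o c) x)) => //.
  move=> x Ux; have [dcx dhx] := (dc x Ux, dh _ (cI _ Ux)).
  have dhc : differentiable (h \o c) x by exact: differentiable_comp.
  rewrite (deriveE v dhc) (diff_comp dcx dhx) /= (deriveE v dcx).
  rewrite -[X in 'd h (c x) X]mulr1 [RHS]linearZ /=; congr (_ *: _).
  by rewrite -(deriveE _ dhx); have [_ ->] := hh' _ (cI _ Ux).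
exact: CkZ.
Qed.

Lemma Ck_exp V k (U : set V) (c : V -> R^o) : open U ->
  Ck k U c -> Ck k U (fun x => expR (c x) : R^o).
Proof.
move=> oU; elim: k => [|k IH] Cc;
  apply: (@Ck_comp1 _ _ _ setT c expR expR) => //.
by move=> j [<-]; apply: IH; exact: Ck_pred.
Qed.

Lemma is_derive_inv (x : R) : x != 0 ->
  is_derive x (1 : R) (fun y : R => y^-1 : R^o) (- (x^-1 * x^-1)).
Proof.
move=> x0; have /= := is_deriveV x0 (is_derive_id (x : R) (1 : R)).
by rewrite /GRing.scale /= mulr1 expr2 invfM.
Qed.

Lemma Ck_inv V k (U : set V) (c : V -> R^o) : open U ->
  (forall x, U x -> c x != 0) ->
  Ck k U c -> Ck k U (fun x => (c x)^-1 : R^o).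
Proof.
move=> oU c0; elim: k => [|k IH] Cc;
  apply: (@Ck_comp1 _ _ _ [set x | x != 0] c (fun x => x^-1)
    (fun x => - (x^-1 * x^-1))) => //=.
- by move=> x; exact: is_derive_inv.
- by move=> x; exact: is_derive_inv.
- move=> j [<-]; have Ci := IH (Ck_pred Cc).
  apply: (@Ck_eq _ _ _ _
    (fun x => (-1 : R^o) *: ((c x)^-1 *: ((c x)^-1 : R^o)))).
  + exact: oU.
  + by move=> x _; rewrite scaleN1r.
  + by apply: CkZ => //; [exact: Ck_cst|exact: CkZ].
Qed.

Lemma Ck_ln V k (U : set V) (c : V -> R^o) : open U ->
  (forall x, U x -> 0 < c x) ->
  Ck k U c -> Ck k U (fun x => ln (c x) : R^o).
Proof.
move=> oU c0 Cc.
apply: (@Ck_comp1 _ _ _ [set x | 0 < x] c (@ln R) (fun x => x^-1)) => //=.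
move=> j kj; apply: Ck_inv => //.
  by move=> x /c0; rewrite lt0r => /andP[].
by apply: Ck_pred; rewrite -kj.
Qed.

End CkCalculus.

(** * Curves in the fibres of a submersion *)

Section FibreCurve.
Variable R : realType.

Lemma rV_linear_continuous (W : normedModType R) m
  (L : {linear 'rV[R]_m -> W}) : continuous L.
Proof.
have -> : (L : 'rV[R]_m -> W) =
    (fun v : 'rV[R]_m => \sum_(i < m) (v 0 i : R^o) *: L (delta_mx 0 i)).
  apply/funext => v; rewrite {1}[v]row_sum_delta linear_sum.
  by apply: eq_bigr => i _; rewrite linearZ.
have C : Ck 0 setT
    (fun v : 'rV[R]_m => \sum_(i < m) (v 0 i : R^o) *: L (delta_mx 0 i)).
  apply: Ck_sum => [|i]; first exact: openT.
  apply: CkZ; [exact: openT| |exact: Ck_cst].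
  by move=> v _; exact: coord_cont.
by move=> x; exact: C.
Qed.

Lemma rV_norm_le m (v : 'rV[R]_m) (r : R) : 0 <= r ->
  (`|v| <= r) <-> (forall i, `|v 0 i| <= r).
Proof.
move=> r0; split=> [vr i|vr].
  apply: le_trans vr; rewrite [leRHS]/Num.Def.normr/= mx_normrE.
  exact: (le_bigmax _ (fun ij => `|v ij.1 ij.2|) (0, i)).
rewrite /Num.Def.normr/= mx_normrE; apply: bigmax_le => // -[i j] _ /=.
by rewrite [i]ord1.
Qed.

(** In finite dimension the fixed point of a contraction [T] of a closed ball
    is found by compactness: at a minimum [w] of [|T w - w|] on the ball, the
    value at [T w] would be at most half of it. *)
Lemma contraction_fixed m (r : R) (T : 'rV[R]_m -> 'rV[R]_m) : 0 <= r ->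
  (forall w, `|w| <= r -> `|T w| <= r) ->
  (forall w w', `|w| <= r -> `|w'| <= r ->
     `|T w - T w'| <= 2^-1 * `|w - w'|) ->
  exists2 w, `|w| <= r & T w = w.
Proof.
move=> r0 Tr Tc; pose B := [set w : 'rV[R]_m | `|w| <= r].
have cB : compact B.
  apply: bounded_closed_compact.
    exists r; split; first exact: num_real.
    by move=> x rx w /= wr; apply: le_trans wr (ltW rx).
  have -> : B = closed_ball_ (fun x => `|x|) 0 r.
    by apply/seteqP; split=> w; rewrite /B /closed_ball_ /= sub0r normrN.
  exact: closed_closed_ball_.
have cT : {within B, continuous (fun w => `|T w - w|)}.
  apply/subspace_continuousP => x Bx; apply/cvgrPdist_le => e e0.
  near=> w => /=.
  have Bw : B w by near: w; exact: withinT.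
  apply: le_trans (ler_dist_dist _ _) _.
  have xw : `|x - w| <= e / 2.
    near: w; apply: cvg_within.
    apply: (@cvgr_dist_le _ _ _ (nbhs x) _ id) => //.
    exact: divr_gt0.
  have := Tc x w Bx Bw.
  have -> : T x - x - (T w - w) = (T x - T w) - (x - w).
    by rewrite !opprB addrACA [RHS]addrACA [- x - _]addrC.
  have := ler_normB (T x - T w) (x - w); lra.
have [|w wB wmin] := EVT_min_rV _ cB cT.
  by exists 0; rewrite /B /= normr0.
have {}wB : `|w| <= r by move: wB; rewrite inE.
exists w => //; apply/eqP; rewrite -subr_eq0 -normr_eq0 eq_le normr_ge0 andbT.
have := wmin (T w); rewrite inE => /(_ (Tr _ wB)).
have := Tc _ _ (Tr _ wB) wB.
lra.
Unshelve. all: by end_near. Qed.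


Lemma linearB_coord m n (A B : {linear 'rV[R]_m -> 'rV[R]_n}) u j :
  (A u - B u) 0 j =
  \sum_(i < m) u 0 i * (A (delta_mx 0 i) - B (delta_mx 0 i)) 0 j.
Proof.
have E (L : {linear 'rV[R]_m -> 'rV[R]_n}) :
    L u = \sum_(i < m) u 0 i *: L (delta_mx 0 i).
  rewrite {1}[u]row_sum_delta linear_sum.
  by apply: eq_bigr => i _; rewrite linearZ.
rewrite E (E B) -sumrB summxE.
by apply: eq_bigr => i _; rewrite -scalerBr mxE.
Qed.

(** Continuity of the partial derivatives makes [f] strictly differentiable:
    on a small ball, [f - 'd f p] is Lipschitz with a small constant, by the
    mean value theorem along segments. *)
Lemma C1_strict_diff m n (U : set 'rV[R]_m) (f : 'rV[R]_m -> 'rV[R]_n) p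
  (e : R) : open U -> Ck 1 U f -> U p -> 0 < e ->
  exists2 d : R, 0 < d & forall x y : 'rV[R]_m, `|x - p| < d -> `|y - p| < d ->
    `|f x - f y - 'd f p (x - y)| <= e * `|x - y|.
Proof.
move=> oU [df Df] Up e0.
(* The [m] partial derivatives share the error [e]. *)
pose e1 := e / m.+1%:R.
have e10 : 0 < e1 by rewrite divr_gt0.
have Dnear : \forall z \near p, U z /\
    forall i : 'I_m, `|'D_(delta_mx 0 i) f z - 'D_(delta_mx 0 i) f p| <= e1.
  near=> z; split; first by near: z; exact: open_nbhs_nbhs.
  near: z; apply: filter_forall => i.
  by have /cvgr_distC_le/(_ _ e10) := Df (delta_mx 0 i) p Up; apply.
have /nbhs_ballP[d d0 dP] := Dnear.
exists d => // x y xd yd; apply/rV_norm_le => [|j].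
  by rewrite mulr_ge0 // ltW.
pose g (t : R) : R := f (y + t *: (x - y)) 0 j.
have ball_seg (t : R) : t \in `[0, 1] -> ball p d (y + t *: (x - y)).
  rewrite in_itv /= => /andP[t0 t1].
  rewrite -ball_normE /= distrC.
  have -> : y + t *: (x - y) - p = (1 - t) *: (y - p) + t *: (x - p).
    by apply/rowP => k; rewrite !mxE; ring.
  apply: le_lt_trans (ler_normD _ _) _.
  rewrite !normrZ (ger0_norm t0) ger0_norm ?subr_ge0 //.
  have [->|tn0] := eqVneq t 0; first by rewrite subr0 mul1r mul0r addr0.
  have tp : 0 < t by rewrite lt0r tn0.
  have A : t * `|x - p| < t * d by rewrite ltr_pM2l.
  have B : (1 - t) * `|y - p| <= (1 - t) * d.
    by rewrite ler_wpM2l ?subr_ge0 // ltW.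
  rewrite addrC (lt_le_trans (ltr_leD A B)) //.
  by rewrite -mulrDl [t + _]addrC subrK mul1r.
pose z (t : R) : 'rV[R]_m := y + t *: (x - y).
pose g' (t : R) : R := ('d f (z t) (x - y)) 0 j.
have gd (t : R) : t \in `[0, 1] -> is_derive t 1 g (g' t).
  move=> t01; have [Uz _] := dP _ (ball_seg t t01).
  have dfz := df _ Uz.
  have [dz dzE] : is_diff t z (0 + (fun h => h *: (x - y))).
    exact: (is_diffD (is_diff_cst _ _) (is_diff_scalel _ _)).
  have dfz' : differentiable (f \o z) t by exact: differentiable_comp.
  have dg : differentiable (@coord_lin _ _ j \o (f \o z)) t.
    apply: differentiable_comp => //; exact/linear_differentiable/coord_cont.
  apply: DeriveDef; first exact: diff_derivable.
  have cj : continuous (@coord_lin R _ j) by exact: coord_cont.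
  rewrite (deriveE _ dg) (diff_comp dfz' (linear_differentiable _ cj)).
  by rewrite (diff_lin _ cj) (diff_comp dz dfz) dzE /= add0r scale1r.
have gd' (t : R) : t \in `]0, 1[ -> is_derive t 1 g (g' t).
  by move=> t01; apply: gd; exact: subset_itv_oo_cc.
have cg : {within `[0, 1], continuous g}.
  by apply: derivable_within_continuous => t /gd[].
have [t t01 gE] := MVT_segment ler01 gd' cg.
have [Uz Dz] := dP _ (ball_seg t t01).
have -> : (f x - f y - 'd f p (x - y)) 0 j =
    \sum_(i < m) (x - y) 0 i *
      ('D_(delta_mx 0 i) f (z t) - 'D_(delta_mx 0 i) f p) 0 j.
  have -> : (f x - f y - 'd f p (x - y)) 0 j =
      ('d f (z t) (x - y) - 'd f p (x - y)) 0 j.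
    rewrite !mxE; congr (_ - _); move: gE; rewrite subr0 mulr1 /g' => <-.
    by rewrite /g scale1r scale0r addr0 [y + _]addrC subrK.
  rewrite linearB_coord; apply: eq_bigr => i _.
  rewrite (deriveE _ (df _ Uz)).
  by rewrite (deriveE _ (df _ Up)).
apply: le_trans (ler_norm_sum _ _ _) _.
apply: (@le_trans _ _ (\sum_(i < m) `|x - y| * e1)).
  apply: ler_sum => i _; rewrite normrM; apply: ler_pM => //.
    by have /(rV_norm_le _ (normr_ge0 _)) := lexx `|x - y|; apply.
  by have /(rV_norm_le _ (ltW e10)) := Dz i; apply.
rewrite sumr_const card_ord -mulr_natr -mulrA mulrC ler_wpM2r //.
by rewrite /e1 mulrAC ler_pdivrMr // ler_pM2l // ler_nat.
Unshelve. all: by end_near. Qed.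

(** A tangent vector [v] of a fibre of [f] is the velocity of a curve in this
    fibre: correct [p + t v] by a vector [S w], for a right inverse [S] of
    ['d f p], where [w] is the fixed point of Newton's map with fixed
    derivative. The correction is [o(t)] since ['d f p v = 0]. *)
Lemma fibre_curve m n (U : set 'rV[R]_m) (f : 'rV[R]_m -> 'rV[R]_n)
    (p v : 'rV[R]_m) :
  open U -> Ck 1 U f -> U p -> (forall w, exists u, 'd f p u = w) ->
  'd f p v = 0 ->
  exists c : R -> 'rV[R]_m, [/\ c 0 = p,
    forall t, U (c t) /\ f (c t) = f p,
    derivable (c : R^o -> 'rV[R]_m) 0 1 &
    'D_1 (c : R^o -> 'rV[R]_m) 0 = v].
Proof.
move=> oU Cf Up surj dfv.
pose L := linfun ('d f p).
pose S : {linear 'rV[R]_n -> 'rV[R]_m} := (L^-1)%VF : _ -> _.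
have LS w : 'd f p (S w) = w.
  have [u <-] := surj w; rewrite -!(lfunE ('d f p)).
  by apply: limg_lfunVK; rewrite memv_img ?memvf.
have df0 x : U x -> differentiable f x by case: Cf => + _; apply.
have [C C0 SC] := linear_lipschitz (@rV_linear_continuous _ _ S).
(* With this Lipschitz constant of [f - 'd f p], Newton's map below is a
   contraction of ratio 1/2. *)
pose e := (2 * C)^-1.
have e0 : 0 < e by rewrite invr_gt0 mulr_gt0.
have [d0 d00 strict] := C1_strict_diff oU Cf Up e0.
have /nbhs_ballP[d1 d10 d1U] := open_nbhs_nbhs (conj oU Up).
pose d := Num.min d0 d1.
have d_gt0 : 0 < d by rewrite lt_min d00.
have dU (x : 'rV[R]_m) : `|x - p| < d -> U x.
  rewrite lt_min => /andP[_ xd]; apply: d1U.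
  by rewrite -ball_normE /= distrC.
have strictd (x y : 'rV[R]_m) : `|x - p| < d -> `|y - p| < d ->
    `|f x - f y - 'd f p (x - y)| <= e * `|x - y|.
  by rewrite !lt_min => /andP[+ _] /andP[+ _]; exact: strict.
(* [S w] corrects [p + t v] to a point of the fibre; the bound on [w] makes the
   correction [o(t)]. *)
pose P (t : R) (w : 'rV[R]_n) :=
  [/\ `|w| <= 2 * `|f (p + t *: v) - f p|,
     f (p + t *: v + S w) = f p & U (p + t *: v + S w)].
have small (a : R) : 0 < a ->
    \forall t \near (0 : R), 2 * `|f (p + t *: v) - f p| <= a * `|t|.
  move=> a0; pose b := a / (2 * (`|v| + 1)).
  have v1 : 0 < `|v| + 1 by rewrite ltr_wpDl.
  have b0 : 0 < b by rewrite divr_gt0 // mulr_gt0.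
  have tv : (fun t : R => t *: v) @ (0 : R) --> (0 : 'rV[R]_m).
    by have := @scalel_continuous _ _ v (0 : R); rewrite /continuous_at scale0r.
  have H : \forall t \near (0 : R),
      `|f (t *: v + p) - f p - 'd f p (t *: v)| <= b * `|t *: v|.
    have D := diff_little (df0 _ Up) b0.
    exact: tv _ D.
  apply: filterS H => t.
  rewrite [_ + p]addrC linearZ /= dfv scaler0 subr0 normrZ => fb.
  apply: (@le_trans _ _ (2 * (b * (`|t| * `|v|)))); first by rewrite ler_pM2l.
  have -> : 2 * (b * (`|t| * `|v|)) = a * `|t| * (`|v| / (`|v| + 1)).
    by rewrite /b; field; rewrite gt_eqF.
  apply: ler_piMr; first by rewrite mulr_ge0 // ltW.
  by rewrite ler_pdivrMr // mul1r lerDl.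
have Pex : \forall t \near (0 : R), exists w, P t w.
  have vC : 0 < `|v| + C by rewrite ltr_wpDl.
  near=> t.
  have td : `|t| * (`|v| + C) < d.
    rewrite -ltr_pdivlMr //.
    near: t; apply/nbhs_ballP; exists (d / (`|v| + C)); first exact: divr_gt0.
    by move=> s; rewrite -ball_normE /= sub0r normrN.
  have rt : 2 * `|f (p + t *: v) - f p| <= 1 * `|t|.
    by near: t; exact: small _ ltr01.
  rewrite mul1r in rt; pose r := 2 * `|f (p + t *: v) - f p|.
  pose q (w : 'rV[R]_n) : 'rV[R]_m := p + t *: v + S w.
  have qd (w : 'rV[R]_n) : `|w| <= r -> `|q w - p| < d.
    move=> wr; apply: le_lt_trans td.
    have -> : q w - p = t *: v + S w by apply/rowP => j; rewrite !mxE; ring.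
    rewrite mulrDr (le_trans (ler_normD _ _)) // lerD ?normrZ //.
    by rewrite (le_trans (SC w)) // mulrC ler_pM2r // (le_trans wr).
  pose T (w : 'rV[R]_n) : 'rV[R]_n := w - (f (q w) - f p).
  have Tc (w w' : 'rV[R]_n) : `|w| <= r -> `|w'| <= r ->
      `|T w - T w'| <= 2^-1 * `|w - w'|.
    move=> wr wr'; have := strictd _ _ (qd _ wr) (qd _ wr').
    have -> : q w - q w' = S (w - w').
      by rewrite linearB /q opprD addrACA subrr add0r.
    rewrite LS -normrN => H; apply: le_trans (le_trans H _).
      rewrite le_eqVlt; apply/orP; left; apply/eqP; congr `|_|.
      by rewrite /T; apply/rowP => j; rewrite !mxE; ring.
    apply: le_trans (ler_wpM2l (ltW e0) (SC _)) _.
    rewrite mulrA le_eqVlt /e; apply/orP; left; apply/eqP.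
    by field; rewrite gt_eqF.
  have r0 : 0 <= r by rewrite mulr_ge0.
  have T0 : 2 * `|T 0| = r.
    by rewrite /T /q linear0 addr0 sub0r normrN.
  have [w wr|w wr Tw] := contraction_fixed r0 _ Tc.
    have := Tc _ 0 wr; rewrite normr0 subr0 => /(_ r0) Tw0.
    by have := ler_normD (T w - T 0) (T 0); rewrite subrK; lra.
  exists w; split => //; last by apply: dU; exact: qd.
  apply/eqP; rewrite -subr_eq0; apply/eqP.
  by rewrite -[LHS]opprK -[- (_ - _)](addKr w) -/(q w) -/(T w) Tw addNr oppr0.
pose c t := if pselect (exists w, P t w) is left ex
            then p + t *: v + S (projT1 (cid ex)) else p.
have c0 : c 0 = p.
  rewrite /c; case: pselect => // ex; case: cid => w /= [w0 _ _].
  move: w0; rewrite scale0r addr0 subrr normr0 mulr0 normr_le0 => /eqP ->.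
  by rewrite linear0 addr0.
(* The correction as a function of time has derivative 0. *)
pose b (t : R) : 'rV[R]_m := c t - (p + t *: v).
have b0 : b 0 = 0 by rewrite /b c0 scale0r addr0 subrr.
have [db dbE] : differentiable b 0 /\ 'd b 0 = \0 :> (R -> 'rV[R]_m).
  apply: diff_intro => [|a a0]; first by move=> x; exact: cst_continuous.
  near=> t; rewrite addr0 b0 !subr0 /b /c; case: pselect => [ex|nex].
    case: cid => w /= [wt _ _]; rewrite addrC addKr.
    rewrite (le_trans (SC w)) // -ler_pdivlMl // (le_trans wt) //.
    rewrite mulrA [C^-1 * a]mulrC; near: t; apply: small; exact: divr_gt0.
  by exfalso; apply: nex; near: t.
have Dv : is_diff (0 : R) (fun t => p + t *: v) (0 + (fun t => t *: v)).
  exact: (is_diffD (is_diff_cst _ _) (is_diff_scalel _ _)).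
have cE : c = b + (fun t => p + t *: v).
  by apply/funext => t; rewrite /b /GRing.add /= subrK.
have [dc dcE] : differentiable (c : R^o -> 'rV[R]_m) 0 /\
    'd (c : R^o -> 'rV[R]_m) 0 1 = v.
  have Db : is_diff (0 : R) b \0 by split.
  have [dc E] := is_diffD Db Dv.
  by rewrite cE; split => //; rewrite E /= !add0r scale1r.
exists c; split => //; last first.
- by rewrite (deriveE (1 : R^o) dc).
- exact: diff_derivable.
by move=> t; rewrite /c; case: pselect => // ex; case: cid => w /= [].
Unshelve. all: by end_near. Qed.

(** The chain rule along a curve. *)
Lemma derive_curve_comp (V W : normedModType R) (c : R^o -> V) (f : V -> W) :
  derivable c 0 1 -> differentiable f (c 0) ->
  derivable (f \o c) 0 1 /\ 'D_1 (f \o c) 0 = 'd f (c 0) ('D_1 c 0).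
Proof.
move=> /derivable1_diffP dc df.
have dfc : differentiable (f \o c) 0 by exact: differentiable_comp.
split; first exact: diff_derivable.
by rewrite (deriveE _ dfc) (deriveE _ dc) (diff_comp dc df).
Qed.

(** The same with the differential as an element of ['Hom], fixed before the
    curve is. *)
Lemma derive_curve_linear m n (f : 'rV[R]_m -> 'rV[R]_n) p :
  differentiable f p ->
  exists T : 'Hom('rV[R]_m, 'rV[R]_n), forall c : R^o -> 'rV[R]_m,
    c 0 = p -> derivable c 0 1 ->
    derivable (f \o c) 0 1 /\ 'D_1 (f \o c) 0 = T ('D_1 c 0).
Proof.
move=> df; exists (linfun ('d f p)) => c c0 dc; rewrite -c0 in df *.
by rewrite lfunE; exact: derive_curve_comp.
Qed.

End FibreCurve.

(** * Tangent maps and velocities in charts *)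

Section Manifolds.
Variable R : realType.

Section OneManifold.
Variables (n : nat) (M : manifold R n).
Implicit Types (phi : chart M) (x : M) (c : R -> M).

Lemma chart_at_dom x : chart_dom (chart_at x) x.
Proof. exact: projT2 (cid (chart_cover x)). Qed.

Lemma chart_img_open_sub phi (U : set M) : open U ->
  open (chart_map phi @` (chart_dom phi `&` U)).
Proof.
move=> oU; rewrite openE => p [x [dx Ux] <-].
have img : (chart_map phi @` chart_dom phi) (chart_map phi x) by exists x.
have nU : nbhs (chart_inv phi (chart_map phi x)) U.
  by rewrite chart_mapK //; exact: open_nbhs_nbhs.
have n1 : \forall q \near chart_map phi x, U (chart_inv phi q).
  exact: chart_inv_continuous img _ nU.
have n2 := open_nbhs_nbhs (conj (@chart_img_open _ _ _ phi) img).
apply: filterS (filterI n1 n2) => q [/= Uq [y dy yq]].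
by exists y => //; split => //; move: Uq; rewrite -yq /= chart_mapK.
Qed.

Lemma chart_img_sub phi (U : set M) p :
  (chart_map phi @` (chart_dom phi `&` U)) p ->
  [/\ chart_dom phi (chart_inv phi p), U (chart_inv phi p) &
      chart_map phi (chart_inv phi p) = p].
Proof. by move=> [x [dx Ux] <-]; rewrite chart_mapK. Qed.

Lemma chart_img_mem phi (U : set M) x : chart_dom phi x -> U x ->
  (chart_map phi @` (chart_dom phi `&` U)) (chart_map phi x).
Proof. by move=> dx Ux; exists x. Qed.

Lemma near_chart_dom phi c : {for 0, continuous c} -> chart_dom phi (c 0) ->
  \forall u \near (0 : R), chart_dom phi (c u).
Proof.
move=> cc dc; apply: cc; apply: open_nbhs_nbhs.
by split => //; exact: chart_dom_open.
Qed.

(** Differentiability and velocity of a curve are read off any coordinate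
    expression of it near time 0. *)
Lemma curve_coord c x (g : R^o -> 'rV[R]_n) : c 0 = x ->
  derivable g 0 1 ->
  (\forall u \near (0 : R), chart_dom (chart_at x) (c u) /\
     chart_map (chart_at x) (c u) = g u) ->
  differentiable_curve c /\ velocity c = 'D_1 g 0.
Proof.
move=> <- dg cg; pose phi := chart_at (c 0).
have gE : \forall u \near (0 : R), g u = (chart_map phi \o c) u.
  by apply: filterS cg => u /= [_ <-].
split; last by apply/esym/near_eq_derive.
split; last exact: near_eq_derivable gE dg.
have cE : \forall u \near (0 : R), (chart_inv phi \o g) u = c u.
  by apply: filterS cg => u /= [du <-]; rewrite chart_mapK.
have c0 : c 0 = chart_inv phi (g 0) by rewrite -(nbhs_singleton cE).
have cg0 : {for (0 : R), continuous g}.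
  exact/differentiable_continuous/derivable1_diffP.
have ci : {for g 0, continuous (chart_inv phi)}.
  apply: chart_inv_continuous; rewrite (nbhs_singleton gE) /=.
  by exists (c 0) => //; exact: chart_at_dom.
have cig : {for (0 : R), continuous (chart_inv phi \o g)}.
  exact: continuous_comp.
suff : c @ (0 : R) --> c 0 by [].
rewrite c0; apply: cvg_trans (near_eq_cvg cE) _; exact: cig.
Qed.

End OneManifold.

Section Maps.
Variables (m n : nat) (M : manifold R m) (N : manifold R n).

(** The expression of [f] in the preferred charts at [x] and [f x]. *)
Definition rep (f : M -> N) (x : M) : 'rV[R]_m -> 'rV[R]_n :=
  chart_map (chart_at (f x)) \o f \o chart_inv (chart_at x).

Definition rep_dom (f : M -> N) (x : M) : set 'rV[R]_m :=
  chart_map (chart_at x) @`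
    (chart_dom (chart_at x) `&` f @^-1` chart_dom (chart_at (f x))).

Lemma rep_dom_open f x : continuous f -> open (rep_dom f x).
Proof.
move=> cf; apply: chart_img_open_sub; apply: open_comp.
  by move=> y _; exact: cf.
exact: chart_dom_open.
Qed.

Lemma rep_dom_mem f x : rep_dom f x (chart_map (chart_at x) x).
Proof. by apply: chart_img_mem; exact: chart_at_dom. Qed.

Lemma rep_smooth f x : smooth_map f -> smooth_on (rep_dom f x) (rep f x).
Proof. by move=> [_]; apply. Qed.

Lemma rep_diff f x : smooth_map f ->
  differentiable (rep f x) (chart_map (chart_at x) x).
Proof.
by move=> /(@rep_smooth f x)/(_ 1%N)[+ _]; apply; exact: rep_dom_mem.
Qed.

Lemma tangent_mapE f x v :
  tangent_map f x v = 'd (rep f x) (chart_map (chart_at x) x) v.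
Proof. by rewrite /tangent_map lfunE. Qed.

Lemma curve_map (f : M -> N) (c : R -> M) : smooth_map f ->
  differentiable_curve c ->
  differentiable_curve (f \o c) /\
  velocity (f \o c) = tangent_map f (c 0) (velocity c).
Proof.
move=> sf [cc dc].
have [dfc fcE] := derive_curve_comp dc (rep_diff (c 0) sf).
have [|dfc' ->] := @curve_coord _ N (f \o c) (f (c 0)) _ erefl dfc.
  have cf : {for c 0, continuous f} by case: sf => + _; apply.
  have cfc : {for 0, continuous (f \o c)} by apply: continuous_comp.
  apply: filterS (filterI (near_chart_dom cc (chart_at_dom _))
    (near_chart_dom cfc (chart_at_dom _))) => u [/= du dfu].
  by rewrite /rep /= chart_mapK.
by split => //; rewrite tangent_mapE fcE.
Qed.

End Maps.

Lemma tangent_map_comp m n p (M : manifold R m) (N : manifold R n)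
    (P : manifold R p) (f : M -> N) (g : N -> P) x v :
  smooth_map f -> smooth_map g ->
  tangent_map (g \o f) x v = tangent_map g (f x) (tangent_map f x v).
Proof.
move=> sf sg; rewrite !tangent_mapE; apply/esym.
apply: diff_chain (rep_diff x sf) _ (rep_diff (f x) sg) _.
  by rewrite /rep /= chart_mapK //; exact: chart_at_dom.
have od : open (rep_dom f x) by apply: rep_dom_open; case: sf.
apply: filterS (open_nbhs_nbhs (conj od (rep_dom_mem f x))).
by move=> q /chart_img_sub[_ /= fq _]; rewrite /rep /= chart_mapK.
Qed.

Lemma tangent_map_id m (M : manifold R m) (x : M) v :
  tangent_map (fun y : M => y) x v = v.
Proof.
rewrite tangent_mapE.
have nE : \forall q \near chart_map (chart_at x) x,
    id q = rep (fun y : M => y) x q.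
  have od : open (rep_dom (fun y : M => y) x).
    by apply: rep_dom_open => y; exact: cvg_id.
  apply: filterS (open_nbhs_nbhs (conj od (rep_dom_mem _ x))).
  by move=> q /chart_img_sub[_ _ qE]; rewrite /rep /= qE.
have [did idE] := is_diff_id (chart_map (chart_at x) x).
by have [_ ->] := near_eq_diff nE did; rewrite idE.
Qed.

Lemma eq_tangent_map m n (M : manifold R m) (N : manifold R n)
  (f g : M -> N) x : f =1 g -> tangent_map f x = tangent_map g x.
Proof. by move=> /funext ->. Qed.

(** For a submersion, every vector of the kernel of the tangent map is the
    velocity of a curve that stays in the fibre. *)
Lemma submersion_curve m n (M : manifold R m) (N : manifold R n)
    (f : M -> N) (x : M) (v : 'rV[R]_m) :
  submersion f -> tangent_map f x v = 0 ->
  exists c : R -> M, [/\ c 0 = x, forall u, f (c u) = f x,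
    differentiable_curve c & velocity c = v].
Proof.
move=> [sf /(_ x) surj] fv.
have od : open (rep_dom f x) by apply: rep_dom_open; case: sf.
have [||g [g0 gU dg gE]] :=
    fibre_curve od (rep_smooth x sf 1%N) (rep_dom_mem f x) (v := v).
- move=> w; have : w \in limg (tangent_map f x) by rewrite surj memvf.
  by move=> /memv_imgP[u _ ->]; exists u; rewrite tangent_mapE.
- by rewrite -tangent_mapE.
pose c u := chart_inv (chart_at x) (g u).
have c0 : c 0 = x by rewrite /c g0 chart_mapK //; exact: chart_at_dom.
have [|dc cE] := @curve_coord _ M c x g c0 dg.
  apply: (@filterE _ (nbhs (0 : R))) => u.
  by have [/chart_img_sub[? _ ?] _] := gU u.
exists c; split => //; last by rewrite cE.
move=> u; have [/chart_img_sub[_ /= fu _] /=] := gU u.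
rewrite /rep /= chart_mapK; last exact: chart_at_dom.
move=> /(congr1 (chart_inv (chart_at (f x)))).
by rewrite !chart_mapK //; exact: chart_at_dom.
Qed.

End Manifolds.

(** * Densities *)

Section DensityAlgebra.
Variable R : realType.
Implicit Types V U W : vectType R.

Definition coords r V (e0 e : r.-tuple V) : 'M[R]_r :=
  \matrix_(i, j) coord e0 i (tnth e j).

(** The density that takes the value 1 on the frame [e0]. The determinant
    vanishes on tuples that are not bases, so that most identities below hold
    for all tuples. *)
Definition vol r V (e0 e : r.-tuple V) : R := `|\det (coords e0 e)|.

Lemma coord_eq r V (e : r.-tuple V) (k : 'I_r -> R) (v : V) i :
  basis_of fullv e -> v = \sum_(j < r) k j *: tnth e j -> coord e i v = k i.
Proof.
move=> /basis_free fe ->.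
under eq_bigr do rewrite (tnth_nth 0).
by rewrite coord_sum_free.
Qed.

Lemma coord_expand r V (e : r.-tuple V) (v : V) : basis_of fullv e ->
  v = \sum_(j < r) coord e j v *: tnth e j.
Proof.
move=> be; rewrite {1}(coord_basis be (memvf v)).
by apply: eq_bigr => j _; rewrite (tnth_nth 0).
Qed.

Lemma frame_mul_coords r V (e0 e : r.-tuple V) :
  basis_of fullv e0 -> frame_mul e0 (coords e0 e) = e.
Proof.
move=> be; apply: eq_from_tnth => j; rewrite tnth_mktuple.
rewrite [RHS](coord_expand _ be).
by apply: eq_bigr => i _; rewrite mxE.
Qed.

Lemma coords_frame_mul r V (e0 e : r.-tuple V) B :
  coords e0 (frame_mul e B) = coords e0 e *m B.
Proof.
apply/matrixP => i j; rewrite !mxE tnth_mktuple linear_sum.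
by apply: eq_bigr => k _; rewrite linearZ /= mxE mulrC.
Qed.

Lemma coords_id r V (e0 : r.-tuple V) :
  basis_of fullv e0 -> coords e0 e0 = 1%:M.
Proof.
move=> be; apply/matrixP => i j; rewrite !mxE (tnth_nth 0).
by rewrite coord_free ?(basis_free be) // eq_sym.
Qed.

Lemma coordsM r V (e0 e e1 : r.-tuple V) : basis_of fullv e ->
  coords e0 e *m coords e e1 = coords e0 e1.
Proof. by move=> be; rewrite -coords_frame_mul frame_mul_coords. Qed.

Lemma coords_unit r V (e0 e : r.-tuple V) : basis_of fullv e0 ->
  (coords e0 e \in unitmx) = basis_of fullv e.
Proof.
move=> be0; apply/idP/idP => [ue|be]; last first.
  by have /mulmx1_unit[] := etrans (coordsM e0 e0 be) (coords_id be0).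
rewrite basisEdim; apply/andP; split; last first.
  by rewrite size_tuple (size_basis be0).
have e0E : e0 = frame_mul e (invmx (coords e0 e)).
  rewrite -[LHS](frame_mul_coords _ be0) -[in RHS](frame_mul_coords e be0).
  apply: eq_from_tnth => j; rewrite !tnth_mktuple.
  under [RHS]eq_bigr do rewrite tnth_mktuple scaler_sumr.
  rewrite exchange_big; apply: eq_bigr => i _ /=.
  under eq_bigr do rewrite scalerA mulrC.
  rewrite -scaler_suml; congr (_ *: _).
  have := mulmxV ue => /matrixP/(_ i j).
  by rewrite frame_mul_coords // coords_id // => <-; rewrite mxE.
have /andP[/eqP <- _] := be0.
apply/span_subvP => v /tnthP[j ->]; rewrite e0E tnth_mktuple.
by apply: memv_suml => i _; apply: memvZ; apply: memv_span; exact: mem_tnth.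
Qed.

Lemma vol_id r V (e0 : r.-tuple V) : basis_of fullv e0 -> vol e0 e0 = 1.
Proof. by move=> be; rewrite /vol coords_id // det1 normr1. Qed.

Lemma vol_gt0 r V (e0 e : r.-tuple V) : basis_of fullv e0 ->
  basis_of fullv e -> 0 < vol e0 e.
Proof.
move=> be0; rewrite -(coords_unit _ be0) unitmxE unitfE => d0.
by rewrite /vol normr_gt0.
Qed.

Lemma vol_eq0 r V (e0 e : r.-tuple V) : basis_of fullv e0 ->
  ~~ basis_of fullv e -> vol e0 e = 0.
Proof.
move=> be0; rewrite -(coords_unit _ be0) unitmxE unitfE negbK => /eqP d0.
by rewrite /vol d0 normr0.
Qed.

Lemma vol_positive r V (e0 : r.-tuple V) : basis_of fullv e0 ->
  positive_density (vol e0).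
Proof.
move=> be0; split; last by move=> e; exact: vol_gt0.
split=> [e|e B _ _]; first exact: vol_eq0.
by rewrite /vol coords_frame_mul det_mulmx normrM mulrC.
Qed.

(** Densities form a line: frames are related by invertible matrices, so the
    value at one frame determines a density. Through this lemma and the next,
    all computations with densities become computations with numbers. *)
Lemma densityE r V (e0 : r.-tuple V) (xi : r.-tuple V -> R) :
  basis_of fullv e0 -> densities xi -> forall e, xi e = xi e0 * vol e0 e.
Proof.
move=> be0 [xi0 xiM] e; have [be|nbe] := boolP (basis_of fullv e); last first.
  by rewrite xi0 // vol_eq0 // mulr0.
rewrite -{1}(frame_mul_coords e be0) xiM //; first by rewrite mulrC.
by rewrite coords_unit.
Qed.

Lemma tensor_densityE a b V W (e0 : a.-tuple V) (f0 : b.-tuple W)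
    (z : a.-tuple V * b.-tuple W -> R) :
  basis_of fullv e0 -> basis_of fullv f0 ->
  tensor (@densities R a V) (@densities R b W) z ->
  forall p, z p = z (e0, f0) * (vol e0 p.1 * vol f0 p.2).
Proof.
move=> be bf [k [xi [eta [H ->]]]] [e f] /=; rewrite !fct_sumE mulr_suml.
apply: eq_bigr => i _; have [Hx He] := H i; rewrite /pure_tensor /=.
by rewrite (densityE be Hx e) (densityE bf He f); ring.
Qed.

Lemma pure_in_tensor (X Y : Type) (P : set (X -> R)) (Q : set (Y -> R)) xi eta :
  P xi -> Q eta -> tensor P Q (pure_tensor xi eta).
Proof.
move=> Px Qe; exists 1%N, (fun=> xi), (fun=> eta); split => //.
by rewrite big_ord1.
Qed.

Lemma densitiesZ r V (c : R) (xi : r.-tuple V -> R) :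
  densities xi -> densities (fun e => c * xi e).
Proof.
move=> [xi0 xiM]; split => [e /xi0 -> |e B be uB]; first by rewrite mulr0.
by rewrite xiM // mulrCA.
Qed.

Lemma tensor_densityZ a b V W (c : R) (xi : a.-tuple V -> R)
    (eta : b.-tuple W -> R) : densities xi -> densities eta ->
  tensor (@densities R a V) (@densities R b W)
    (fun p => c * (xi p.1 * eta p.2)).
Proof.
move=> dx de; suff -> : (fun p => c * (xi p.1 * eta p.2)) =
  pure_tensor (fun e => c * xi e) eta.
  by apply: pure_in_tensor => //; exact: densitiesZ.
by apply/funext => p; rewrite /pure_tensor mulrA.
Qed.

Section ExactSequence.
Variables (a b : nat) (V U W : vectType R) (i : 'Hom(V, U)) (p : 'Hom(U, W)).
Hypothesis pi0 : forall v, p (i v) = 0.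

Lemma exact_basis (e : a.-tuple V) (f : b.-tuple U) :
  (forall v, i v = 0 -> v = 0) -> \dim {:U} = (a + b)%N ->
  basis_of fullv e -> basis_of fullv (map_tuple p f) ->
  basis_of fullv (cat_tuple (map_tuple i e) f).
Proof.
move=> injI dU be bf; rewrite basisEfree subvf dU size_tuple leqnn !andbT.
apply/freeP => k; rewrite big_split_ord /= => k0.
have k0' : \sum_(j < a) k (lshift b j) *: i (tnth e j) +
    \sum_(j < b) k (rshift a j) *: tnth f j = 0.
  rewrite -[RHS]k0; congr (_ + _); apply: eq_bigr => j _.
    by rewrite nth_cat size_map size_tuple ltn_ord (nth_map 0) ?size_tuple //
      (tnth_nth 0).
  rewrite nth_cat size_map size_tuple ltnNge leq_addr /= addKn.
  by rewrite (tnth_nth 0).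
have kr j : k (rshift a j) = 0.
  have <- := @coord_eq _ _ _ (fun j => k (rshift a j)) 0 j bf.
    exact: linear0.
  rewrite -[LHS](linear0 p) -k0' linearD !linear_sum /= big1 ?add0r.
    by apply: eq_bigr => l _; rewrite linearZ tnth_map.
  by move=> l _; rewrite linearZ /= pi0 scaler0.
have kl j : k (lshift b j) = 0.
  have <- := @coord_eq _ _ _ (fun j => k (lshift b j)) 0 j be.
    exact: linear0.
  apply/esym/injI; rewrite -[RHS]k0' [X in _ = _ + X]big1 ?addr0; last first.
    by move=> l _; rewrite kr scale0r.
  by rewrite linear_sum; apply: eq_bigr => l _; rewrite linearZ.
by move=> j; case: (split_ordP j) => l ->; [exact: kl|exact: kr].
Qed.

(** In frames adapted to the sequence the matrix of a change of frame is block
    triangular; its diagonal blocks are the changes of frame at the ends. *)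
Lemma vol_exact (e0 e : a.-tuple V) (f0 f : b.-tuple U) :
  basis_of fullv e0 -> basis_of fullv (map_tuple p f0) ->
  basis_of fullv (cat_tuple (map_tuple i e0) f0) ->
  vol (cat_tuple (map_tuple i e0) f0) (cat_tuple (map_tuple i e) f) =
  vol e0 e * vol (map_tuple p f0) (map_tuple p f).
Proof.
move=> be bf bu; set u0 := cat_tuple _ _.
have tl j (g : b.-tuple U) (e1 : a.-tuple V) :
    tnth (cat_tuple (map_tuple i e1) g) (lshift b j) = i (tnth e1 j).
  by rewrite tnth_lshift tnth_map.
have tr j (g : b.-tuple U) (e1 : a.-tuple V) :
    tnth (cat_tuple (map_tuple i e1) g) (rshift a j) = tnth g j.
  by rewrite tnth_rshift.
(* the coordinates of [i v] in [u0] *)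
pose k (v : V) (l : 'I_(a + b)) : R :=
  match fintype.split l with inl l => coord e0 l v | inr _ => 0 end.
have cl v l : coord u0 l (i v) = k v l.
  apply: coord_eq bu _; rewrite big_split_ord /= [X in _ + X]big1 ?addr0.
    rewrite {1}(coord_expand v be) linear_sum; apply: eq_bigr => j _.
    by rewrite tl linearZ /k (unsplitK (inl j)).
  by move=> j _; rewrite /k (unsplitK (inr j)) scale0r.
have cr j w : coord u0 (rshift a j) w = coord (map_tuple p f0) j (p w).
  apply/esym/(coord_eq (k := fun j => coord u0 (rshift a j) w)) => //.
  rewrite {1}(coord_expand w bu) linear_sum big_split_ord /= big1 ?add0r.
    by apply: eq_bigr => l _; rewrite linearZ tr tnth_map.
  by move=> l _; rewrite tl linearZ /= pi0 scaler0.
rewrite /vol -normrM.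
have -> : coords u0 (cat_tuple (map_tuple i e) f) =
    block_mx (coords e0 e) (ursubmx (coords u0 (cat_tuple (map_tuple i e) f)))
      0 (coords (map_tuple p f0) (map_tuple p f)).
  rewrite -[LHS]submxK; congr block_mx; apply/matrixP => l m; rewrite !mxE.
  - by rewrite tl cl /k (unsplitK (inl l)).
  - by rewrite tl cl /k (unsplitK (inr l)).
  - by rewrite tr cr tnth_map.
by rewrite det_ublock.
Qed.

(** The conditions that define the isomorphism are consistent by [vol_exact] and
    fix the image, since they include its value at one adapted frame. *)
Lemma density_exactE (e0 : a.-tuple V) (f0 : b.-tuple U) z :
  basis_of fullv e0 -> basis_of fullv (map_tuple p f0) ->
  basis_of fullv (cat_tuple (map_tuple i e0) f0) ->
  tensor (@densities R a V) (@densities R b W) z ->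
  density_exact i p z = fun u => z (e0, map_tuple p f0) *
    vol (cat_tuple (map_tuple i e0) f0) u.
Proof.
move=> be bf bu tz; rewrite /density_exact.
set S := [set zeta | _].
have S0 : S (fun u => z (e0, map_tuple p f0) *
    vol (cat_tuple (map_tuple i e0) f0) u).
  split; first by apply: densitiesZ; have [] := vol_positive bu.
  by move=> e f be' bf'; rewrite vol_exact // [RHS](tensor_densityE be bf tz).
have [dz zE] := xgetPex 0 (ex_intro S _ S0).
by apply/funext => u; rewrite (densityE bu dz) zE.
Qed.

End ExactSequence.

Lemma vol_map r V U (h : 'Hom(V, U)) (e0 e : r.-tuple V) :
  basis_of fullv e0 -> basis_of fullv (map_tuple h e0) ->
  vol (map_tuple h e0) (map_tuple h e) = vol e0 e.
Proof.
move=> be bh; rewrite /vol; congr (`|\det _|); apply/matrixP => i j.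
rewrite !mxE; apply: (coord_eq (k := fun i => coord e0 i (tnth e j))) => //.
rewrite tnth_map {1}(coord_expand (tnth e j) be) linear_sum.
by apply: eq_bigr => l _; rewrite linearZ tnth_map.
Qed.

Lemma dual_frame_basis r V (e : r.-tuple V) :
  basis_of fullv e -> basis_of fullv (dual_frame e).
Proof.
move=> be; apply/andP; split.
  rewrite eqEsubv subvf /=; apply/subvP => phi _.
  have -> : phi = \sum_(i < r) phi (tnth e i) *: tnth (dual_frame e) i.
    apply/lfunP => v; rewrite sum_lfunE {1}(coord_expand v be) linear_sum.
    apply: eq_bigr => i _; rewrite linearZ /= scale_lfunE tnth_mktuple lfunE.
    by rewrite /GRing.scale /= mulrC.
  by apply: memv_suml => i _; apply: memvZ; apply: memv_span; exact: mem_tnth.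
apply/freeP => k k0 i.
have /lfunP/(_ (tnth e i)) := k0; rewrite sum_lfunE zero_lfunE => <-.
rewrite (bigD1 i) //= big1 ?addr0.
  rewrite scale_lfunE nth_mktuple lfunE /= (tnth_nth 0).
  by rewrite coord_free ?(basis_free be)// eqxx /GRing.scale /= mulr1.
move=> j ji; rewrite scale_lfunE nth_mktuple lfunE /= (tnth_nth 0).
rewrite coord_free ?(basis_free be) // eq_sym (negbTE ji).
by rewrite /GRing.scale /= mulr0.
Qed.

(** The matrix relating dual frames is the transposed inverse. *)
Lemma vol_dual r V (e0 e : r.-tuple V) :
  basis_of fullv e0 -> basis_of fullv e ->
  vol e0 e * vol (dual_frame e0) (dual_frame e) = 1.
Proof.
move=> be0 be; have -> : vol (dual_frame e0) (dual_frame e) = vol e e0.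
  rewrite /vol -det_tr; congr (`|\det _|); apply/matrixP => i j; rewrite !mxE.
  apply: (coord_eq (k := fun j => coord e i (tnth e0 j))).
    exact: dual_frame_basis.
  apply/lfunP => v; rewrite sum_lfunE tnth_mktuple lfunE /=.
  rewrite {1}(coord_expand v be0) linear_sum.
  apply: eq_bigr => l _; rewrite linearZ /= scale_lfunE tnth_mktuple lfunE.
  by rewrite /GRing.scale /= mulrC.
by rewrite /vol -normrM -det_mulmx coordsM // coords_id // det1 normr1.
Qed.

End DensityAlgebra.

(** * The action of an arrow on transverse densities *)

Lemma frame_exists (R : realType) (V : vectType R) r :
  \dim {:V} = r -> exists e : r.-tuple V, basis_of fullv e.
Proof. by move=> <-; exists (vbasis fullv); exact: vbasisP. Qed.

Lemma injective_basis (R : realType) r (V U : vectType R) (h : 'Hom(V, U))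
    (e : r.-tuple V) : \dim {:U} = r -> (forall v, h v = 0 -> v = 0) ->
  basis_of fullv e -> basis_of fullv (map_tuple h e).
Proof.
move=> dU injh be; have kerh : (fullv :&: lker h)%VS = 0%VS.
  apply/eqP; rewrite -subv0; apply/subvP => v; rewrite memv_cap memvf memv_ker.
  by move=> /eqP/injh ->; exact: mem0v.
have := limg_basis_of kerh be.
suff -> : limg h = fullv by [].
apply/eqP; rewrite eqEdim subvf dU.
by rewrite (limg_dim_eq kerh) (size_basis be) /=.
Qed.

Lemma velocity_cst (R : realType) n (M : manifold R n) (c : R -> M) x :
  (forall u, c u = x) -> velocity c = 0.
Proof.
move=> cx; have -> : c = fun=> x by apply/funext.
exact: derive_cst.
Qed.

Section ArrowAction.
Variables (R : realType) (n r : nat) (G : lie_groupoid R n r).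
Local Notation M := (obj G).
Local Notation T_M := 'rV[R]_n.
Local Notation T_G := 'rV[R]_(r + n).
Local Notation A x := (subvs_of (algebroid (G := G) x)).
Implicit Types (x y : obj G) (g h : arr G).

(** In charts, [g' |-> g' h] on the fibre of [src] over [tgt h] is the
    restriction of a smooth map, so it acts linearly on velocities. *)
Lemma right_mult_velocity g h : src g = tgt h ->
  exists T : 'Hom(T_G, T_G), forall d : R -> arr G,
    d 0 = g -> (forall u, src (d u) = tgt h) -> differentiable_curve d ->
    differentiable_curve (fun u => gmul (d u) h) /\
    velocity (fun u => gmul (d u) h) = T (velocity d).
Proof.
move=> gh.
have [W [F [oW Wgh sF FE]]] := gmul_smooth gh (chart_at_dom g)
  (chart_at_dom h) (chart_at_dom (gmul g h)).
pose q := chart_map (chart_at h) h.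
pose F1 (v : T_G) := F (v, q).
have dF : differentiable F1 (chart_map (chart_at g) g).
  have dFp : differentiable F (chart_map (chart_at g) g, q).
    by have [+ _] := sF 1%N; apply.
  have dp : differentiable (fun v : T_G => (v, q)) (chart_map (chart_at g) g).
    exact: differentiable_pair.
  exact: (differentiable_comp dp dFp).
have [T TE] := derive_curve_linear dF.
exists T => d d0 dh [cd dd].
pose c : R^o -> T_G := chart_map (chart_at g) \o d.
have vE : velocity d = 'D_1 c 0 by rewrite /velocity d0.
have dc : derivable c 0 1 by move: dd; rewrite d0.
have cdiff : differentiable c 0 by apply/derivable1_diffP; exact: dc.
have c0 : c 0 = chart_map (chart_at g) g by rewrite /c /= d0.
have [dFc FcE] := TE c c0 dc.
have [|dmc mcE] := curve_coord (c := fun u => gmul (d u) h)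
    (congr1 (fun k => gmul k h) d0) dFc.
  have nW : \forall u \near (0 : R), W (c u, q).
    have cp : {for (0 : R), continuous (fun u => (c u, q))}.
      apply: differentiable_continuous.
      apply: differentiable_pair; first exact: cdiff.
      exact: differentiable_cst.
    by apply: cp; apply: open_nbhs_nbhs; rewrite c0.
  have nd : \forall u \near (0 : R), chart_dom (chart_at g) (d u).
    by apply: near_chart_dom => //; rewrite d0; exact: chart_at_dom.
  apply: filterS (filterI nd nW) => u [du Wu].
  exact: FE _ _ du (chart_at_dom _) Wu (dh u).
by split; [exact: dmc|rewrite vE -FcE -mcE].
Qed.

Lemma algebroid_curve y (a : A y) : exists c : R -> arr G,
  [/\ c 0 = gunit y, forall u, src (c u) = y, differentiable_curve c &
      velocity c = vsval a].
Proof.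
have ka : tangent_map (@src _ _ _ G) (gunit y) (vsval a) = 0.
  by apply/eqP; rewrite -memv_ker; exact: subvsP.
have [c [c0 sc dc vc]] := submersion_curve (@src_submersion _ _ _ G) ka.
by exists c; split => // u; rewrite sc src_gunit.
Qed.

(** The chart expression of the multiplication provides a linear map with the
    property that defines the right translation. That the property also fixes
    this map, which the lemmas below need, is [algebroid_curve]: each vector of
    the algebroid is a velocity in the fibre. *)
Lemma right_translationP y g : tgt g = y ->
  forall c : R -> arr G, c 0 = gunit y -> (forall u, src (c u) = y) ->
    differentiable_curve c -> forall a : A y, vsval a = velocity c ->
    right_translation y g a = velocity (fun u => gmul (c u) g).
Proof.
move=> gy; pose P := [set L : 'Hom(A y, T_G) |
    forall c : R -> arr G, c 0 = gunit y -> (forall u, src (c u) = y) ->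
      differentiable_curve c ->
      forall a : A y, vsval a = velocity c ->
        L a = velocity (fun u => gmul (c u) g)].
suff [L PL] : exists L, P L by apply: (xgetPex 0 (ex_intro P L PL)).
have [|T TE] := @right_mult_velocity (gunit y) g; first by rewrite src_gunit.
exists (T \o linfun vsval)%VF => c c0 sc dc a av.
have [|_ ->] := TE c c0 _ dc; first by move=> u; rewrite sc.
by rewrite comp_lfunE lfunE /= av.
Qed.

Lemma right_translation_curve y g (a : A y) : tgt g = y ->
  exists c : R -> arr G, [/\ c 0 = gunit y, forall u, src (c u) = y,
    differentiable_curve (fun u => gmul (c u) g) & 
    velocity c = vsval a /\
    velocity (fun u => gmul (c u) g) = right_translation y g a].
Proof.
move=> gy; have [c [c0 sc dc vc]] := algebroid_curve a.
have [|T TE] := @right_mult_velocity (gunit y) g; first by rewrite src_gunit.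
have [|dcg _] := TE c c0 _ dc; first by move=> u; rewrite sc.
by exists c; split => //; split => //; rewrite (right_translationP gy c0).
Qed.

Lemma right_translation_src y g (a : A y) : tgt g = y ->
  tangent_map (@src _ _ _ G) g (right_translation y g a) = 0.
Proof.
move=> gy; have [c [c0 sc dcg [_ <-]]] := right_translation_curve a gy.
have [_] := curve_map (@src_submersion _ _ _ G).1 dcg.
rewrite c0 -gy gmul1l => <-; apply: (@velocity_cst _ _ _ _ (src g)) => u /=.
by rewrite src_gmul // sc.
Qed.

(** Translation by [ginv g] brings the translated curve back. *)
Lemma right_translation_inj y g (a : A y) : tgt g = y ->
  right_translation y g a = 0 -> a = 0.
Proof.
move=> gy; have [c [c0 sc dcg [vc <-]]] := right_translation_curve a gy.
move=> v0; have [|T TE] := @right_mult_velocity g (ginv g).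
  by rewrite tgt_ginv.
have [| |_] := TE (fun u => gmul (c u) g) _ _ dcg.
- by rewrite c0 -gy gmul1l.
- by move=> u; rewrite src_gmul ?tgt_ginv // sc.
rewrite v0 linear0.
have -> : (fun u => gmul (gmul (c u) g) (ginv g)) = c.
  apply/funext => u; rewrite -gmulA ?tgt_ginv ?sc // gmulVr.
  by rewrite gy -(sc u) gmul1r.
by rewrite vc => a0; apply: val_inj; rewrite /= a0.
Qed.

(** This is where the fibres of [src] have dimension [r]: the tangent map of the
    submersion [src] has rank [n]. *)
Lemma dim_algebroid x : \dim {: A x} = r.
Proof.
rewrite dimvf /= /dim /=.
have := limg_ker_dim (tangent_map (@src _ _ _ G) (gunit x)) fullv.
rewrite capfv (src_submersion G).2 !dimvf /dim /= !mul1n.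
by move=> /addIn.
Qed.

Lemma dim_rV m : \dim {: 'rV[R]_m} = m.
Proof. by rewrite dimvf /dim /= mul1n. Qed.

(** Under the isomorphism of an exact sequence, the frames [a], [w] of the ends
    correspond to one frame of the middle term. *)
Lemma density_arrowE y g (a : r.-tuple (A y)) (w : n.-tuple T_M) :
  tgt g = y -> basis_of fullv a -> basis_of fullv w ->
  exists2 u : (r + n).-tuple T_G, basis_of fullv u &
    forall z, tensor (@densities R r (A y)) (@densities R n T_M) z ->
      density_arrow g z = fun e => z (a, w) * vol u e.
Proof.
move=> gy ba bw; pose p := tangent_map (@src _ _ _ G) g.
pose f := map_tuple (p^-1)%VF w.
have pf : map_tuple p f = w.
  apply: eq_from_tnth => j; rewrite !tnth_map limg_lfunVK //.
  by rewrite /p (src_submersion G).2 memvf.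
have pi0 v : p (right_translation y g v) = 0 by exact: right_translation_src.
have bpf : basis_of fullv (map_tuple p f) by rewrite pf.
have bu : basis_of fullv (cat_tuple (map_tuple (right_translation y g) a) f).
  apply: (exact_basis pi0) => //; last exact: dim_rV.
  by move=> v; exact: right_translation_inj.
exists (cat_tuple (map_tuple (right_translation y g) a) f) => // z tz.
by rewrite /density_arrow (density_exactE pi0 ba bpf bu tz) pf.
Qed.

Lemma ginvK g : ginv (ginv g) = g.
Proof.
rewrite -[LHS]gmul1r src_ginv tgt_ginv -gmulVl.
rewrite gmulA ?tgt_ginv ?src_ginv //; last by rewrite tgt_ginv.
by rewrite gmulVl src_ginv gmul1l.
Qed.

Lemma tangent_ginv_inj g v : tangent_map (@ginv _ _ _ G) g v = 0 -> v = 0.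
Proof.
move=> v0; have s := @ginv_smooth _ _ _ G.
have E : tangent_map (fun k : arr G => k) g =
    tangent_map (@ginv _ _ _ G \o ginv (l := G)) g.
  by apply: eq_tangent_map => k /=; rewrite ginvK.
have C := etrans (tangent_map_comp g v s s)
  (congr1 (tangent_map (@ginv _ _ _ G) (ginv g)) v0).
have EV := congr1 (fun L : 'Hom(T_G, T_G) => L v) E.
rewrite -[LHS](@tangent_map_id _ _ (arr G) g).
rewrite /= in EV; apply: (etrans EV); apply: (etrans C); exact: linear0.
Qed.

(** In frames both isomorphisms that make up the swap multiply by positive
    numbers, and so does the pullback by the inversion. *)
Lemma density_swapE g (ay : r.-tuple (A (tgt g))) (ax : r.-tuple (A (src g)))
    (w : n.-tuple T_M) :
  basis_of fullv ay -> basis_of fullv ax -> basis_of fullv w ->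
  exists2 k : R, 0 < k &
    forall z, tensor (@densities R r (A (tgt g))) (@densities R n T_M) z ->
      density_swap z = fun p => k * z (ay, w) * (vol ax p.1 * vol w p.2).
Proof.
move=> bay bax bw.
have [u bu uE] := density_arrowE (erefl (tgt g)) bay bw.
have [u' bu' u'E] := density_arrowE (tgt_ginv g) bax bw.
pose h := tangent_map (@ginv _ _ _ G) g.
have bhu : basis_of fullv (map_tuple h u).
  by apply: injective_basis bu; [exact: dim_rV|exact: tangent_ginv_inj].
have [bd' bd] := (vol_positive bu', vol_positive bu).
have k0 : 0 < vol u' (map_tuple h u) by exact: vol_gt0.
have pullE e : vol u' (map_tuple h e) = vol u' (map_tuple h u) * vol u e.
  by rewrite (densityE bhu bd'.1 (map_tuple h e)) vol_map.
exists (vol u' (map_tuple h u))^-1; first by rewrite invr_gt0.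
move=> z tz; rewrite /density_swap; set S := [set z' | _].
have S1 : S (fun p => (vol u' (map_tuple h u))^-1 * z (ay, w) *
    (vol ax p.1 * vol w p.2)).
  have tz' := tensor_densityZ ((vol u' (map_tuple h u))^-1 * z (ay, w))
    (vol_positive bax).1 (vol_positive bw).1.
  split; first exact: tz'.
  rewrite (uE _ tz) (u'E _ tz'); apply/funext => e.
  rewrite /density_pullback -/h (pullE e) /= !vol_id // !mulr1.
  by field; rewrite gt_eqF.
have := xgetPex 0 (ex_intro S _ S1); move: (xget 0 S) => z' [tz' z'E].
apply/funext => p; rewrite (tensor_densityE bax bw tz' p); congr (_ * _).
move: z'E; rewrite (uE _ tz) (u'E _ tz') => /(congr1 (fun f => f u)).
rewrite /density_pullback -/h vol_id // mulr1 => <-.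
by rewrite mulrC mulfK // gt_eqF.
Qed.

(** On pure tensors the action multiplies the coefficient with respect to fixed
    frames by a positive constant. The pairing with all [xi] is compatible with
    changes of frame because dual frames change by the transposed inverse. *)
Lemma arrow_actionE g (ay : r.-tuple (A (tgt g))) (ax : r.-tuple (A (src g)))
    (w : n.-tuple T_M) :
  basis_of fullv ay -> basis_of fullv ax -> basis_of fullv w ->
  exists2 k : R, 0 < k & forall eta kappa,
    @densities R r 'Hom(A (src g), R^o) eta -> @densities R n T_M kappa ->
    arrow_action (pure_tensor eta kappa) =
    fun p => k * (eta (dual_frame ax) * kappa w) *
      (vol (dual_frame ay) p.1 * vol w p.2).
Proof.
move=> bay bax bw; have [k k0 kE] := density_swapE bay bax bw.
have [bdx bdy] := (dual_frame_basis bax, dual_frame_basis bay).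
have swapE xi kappa p : @densities R r (A (tgt g)) xi ->
    @densities R n T_M kappa ->
    density_swap (pure_tensor xi kappa) p =
    k * (xi ay * kappa w) * (vol ax p.1 * vol w p.2).
  by move=> dxi dka; rewrite kE //; exact: pure_in_tensor.
exists k => // eta kappa deta dka; rewrite /arrow_action.
set S := [set tau | _].
have S1 : S (fun p => k * (eta (dual_frame ax) * kappa w) *
      (vol (dual_frame ay) p.1 * vol w p.2)).
  split.
    exact: (tensor_densityZ _ (vol_positive bdy).1 (vol_positive bw).1).
  move=> eta' kappa' xi deta' dka' dxi zE a b f ba bb bf.
  rewrite swapE //=.
  have /(congr1 (fun z => z (dual_frame ax, w))) := zE.
  rewrite /pure_tensor /= => ->.
  rewrite (densityE bay dxi a) (densityE bdx deta' (dual_frame b)).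
  have E1 := vol_dual bay ba; have E2 := vol_dual bax bb.
  transitivity (xi ay * k * (eta' (dual_frame ax) * kappa' w) * vol w f *
    (vol ay a * vol (dual_frame ay) (dual_frame a))); first by ring.
  transitivity (xi ay * k * (eta' (dual_frame ax) * kappa' w) * vol w f *
    (vol ax b * vol (dual_frame ax) (dual_frame b))); last by ring.
  exact: (congr1 ( *%R _) (etrans E1 (esym E2))).
have := xgetPex (fun=> 0) (ex_intro S _ S1); move: (xget _ S) => tau [tl tE].
apply/funext => p; rewrite (tensor_densityE bdy bw tl p); congr (_ * _).
have := tE eta kappa (vol ay) deta dka (vol_positive bay).1 erefl ay ax w
  bay bax bw.
rewrite (vol_id bay) mul1r => ->.
rewrite (swapE _ _ _ (vol_positive bay).1 dka) /=.
have H : forall a b c e f : R, a = 1 -> b = 1 -> c = 1 ->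
    e * (k * (a * f) * (b * c)) = k * (e * f).
  by move=> a b c e f -> -> ->; ring.
exact: H (vol_id bay) (vol_id bax) (vol_id bw).
Qed.

End ArrowAction.

(** * Smooth local frames *)

Section Transitions.
Variable R : realType.

(** The differential applied to a moving vector is a combination of partial
    derivatives of [f]; so transported vector fields are smooth. *)
Lemma Ck_diff_apply (V W : normedModType R) m k (U : set V)
    (U' : set 'rV[R]_m) (f : 'rV[R]_m -> W) (g w : V -> 'rV[R]_m) :
  open U -> (forall x, U x -> U' (g x)) -> smooth_on U' f ->
  Ck k U g -> Ck k U w -> Ck k U (fun x => 'd f (g x) (w x)).
Proof.
move=> oU gU sf Cg Cw.
apply: (@Ck_eq _ _ _ _ _ (fun x =>
  \sum_(i < m) (w x 0 i : R^o) *: 'D_(delta_mx 0 i) f (g x))) => //.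
  move=> x Ux; rewrite diff_rV; apply: eq_bigr => i _.
  by have [df _] := sf 1%N; rewrite (deriveE _ (df _ (gU _ Ux))).
apply: Ck_sum => // i; apply: CkZ => //; first exact: Ck_coord.
apply: (@Ck_comp _ _ _ _ _ _ U' g ('D_(delta_mx 0 i) f)) => //.
by have [_] := sf k.+1; apply.
Qed.

Variables (n : nat) (N : manifold R n).
Implicit Types (phi psi chi : chart N) (y : N).

(** The vector of [T_yN] with components [v] in the chart [psi]. *)
Definition from_chart psi y (v : 'rV[R]_n) : 'rV[R]_n :=
  'd (chart_map (chart_at y) \o chart_inv psi) (chart_map psi y) v.

Lemma transition_diff phi psi y : chart_dom phi y -> chart_dom psi y ->
  differentiable (chart_map psi \o chart_inv phi) (chart_map phi y).
Proof.
move=> dphi dpsi; have [+ _] := @chart_transition_smooth _ _ N phi psi 1%N.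
by apply; exists y.
Qed.

Lemma transition_comp phi psi chi y v : chart_dom phi y -> chart_dom psi y ->
  chart_dom chi y ->
  'd (chart_map chi \o chart_inv psi) (chart_map psi y)
    ('d (chart_map psi \o chart_inv phi) (chart_map phi y) v) =
  'd (chart_map chi \o chart_inv phi) (chart_map phi y) v.
Proof.
move=> dphi dpsi dchi.
apply: diff_chain (transition_diff dphi dpsi) _ (transition_diff dpsi dchi) _.
  by rewrite /= chart_mapK.
have oI := @chart_img_open_sub _ _ _ phi _ (@chart_dom_open _ _ _ psi).
apply: filterS (open_nbhs_nbhs (conj oI (chart_img_mem dphi dpsi))).
by move=> q /chart_img_sub[_ dq _] /=; rewrite chart_mapK.
Qed.

Lemma transition_id phi y v : chart_dom phi y ->
  'd (chart_map phi \o chart_inv phi) (chart_map phi y) v = v.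
Proof.
move=> dphi; have nE : \forall q \near chart_map phi y,
    id q = (chart_map phi \o chart_inv phi) q.
  have oI := @chart_img_open _ _ N phi.
  have mI : (chart_map phi @` chart_dom phi) (chart_map phi y) by exists y.
  apply: filterS (open_nbhs_nbhs (conj oI mI)).
  by move=> q [z dz <-] /=; rewrite chart_mapK.
have [did idE] := is_diff_id (chart_map phi y).
by have [_ ->] := near_eq_diff nE did; rewrite idE.
Qed.

Lemma components_from_chart phi psi y v : chart_dom phi y -> chart_dom psi y ->
  components psi y (from_chart phi y v) =
  'd (chart_map psi \o chart_inv phi) (chart_map phi y) v.
Proof.
by move=> dphi dpsi; apply: transition_comp => //; exact: chart_at_dom.
Qed.

Lemma from_chart_inj phi y v :
  chart_dom phi y -> from_chart phi y v = 0 -> v = 0.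
Proof.
move=> dphi v0.
have E := etrans (components_from_chart v dphi dphi) (transition_id v dphi).
have C0 : components phi y 0 = 0 by rewrite /components; exact: linear0.
exact: etrans (esym E) (etrans (congr1 (components phi y) v0) C0).
Qed.

End Transitions.

Section Fields.
Variable R : realType.

Lemma tangent_map_from_chart m n (M : manifold R m) (N : manifold R n)
    (f : M -> N) (phi : chart M) (psi : chart N) x v :
  smooth_map f -> chart_dom phi x -> chart_dom psi (f x) ->
  tangent_map f x (from_chart phi x v) =
  from_chart psi (f x)
    ('d (chart_map psi \o f \o chart_inv phi) (chart_map phi x) v).
Proof.
move=> sf dx dfx; rewrite tangent_mapE.
have oI : open (chart_map phi @` (chart_dom phi `&` f @^-1` chart_dom psi)).
  apply: chart_img_open_sub; apply: open_comp; last exact: chart_dom_open.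
  by move=> z _; case: sf => + _; apply.
have nI : \forall q \near chart_map phi x, chart_dom phi (chart_inv phi q) /\
    chart_dom psi (f (chart_inv phi q)).
  apply: filterS (open_nbhs_nbhs (conj oI (chart_img_mem dx dfx))).
  by move=> q /chart_img_sub[].
have oJ := @chart_img_open_sub _ _ _ phi _
  (@chart_dom_open _ _ _ (chart_at x)).
have nJ : \forall q \near chart_map phi x,
    chart_dom (chart_at x) (chart_inv phi q).
  apply: filterS (open_nbhs_nbhs (conj oJ (chart_img_mem dx (chart_at_dom x)))).
  by move=> q /chart_img_sub[].
have dF : differentiable (chart_map psi \o f \o chart_inv phi)
    (chart_map phi x).
  by case: sf => _ /(_ phi psi 1%N)[+ _]; apply; exact: chart_img_mem.
have L : 'd (rep f x) (chart_map (chart_at x) x)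
    ('d (chart_map (chart_at x) \o chart_inv phi) (chart_map phi x) v) =
    'd (chart_map (chart_at (f x)) \o f \o chart_inv phi) (chart_map phi x) v.
  apply: diff_chain (transition_diff dx (chart_at_dom x)) _ (rep_diff x sf) _.
    by rewrite /= chart_mapK.
  by apply: filterS nJ => q dq; rewrite /rep /= chart_mapK.
apply: (etrans L); apply/esym.
apply: diff_chain dF _ (transition_diff dfx (chart_at_dom (f x))) _.
  by rewrite /= chart_mapK.
by apply: filterS nI => q [_ dq] /=; rewrite chart_mapK.
Qed.


(** Changes of charts are smooth, so one pair of charts suffices to test the
    smoothness of a field. *)
Lemma smooth_field_coord m n (M : manifold R m) (N : manifold R n)
    (h : M -> N) (phi0 : chart M) (psi0 : chart N) (U : set M)
    (w : 'rV[R]_m -> 'rV[R]_n) (X : M -> 'rV[R]_n) :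
  smooth_map h -> open U ->
  (forall x, U x -> chart_dom phi0 x /\ chart_dom psi0 (h x)) ->
  smooth_on (chart_map phi0 @` U) w ->
  (forall x, U x -> X x = from_chart psi0 (h x) (w (chart_map phi0 x))) ->
  smooth_field_along h U X.
Proof.
move=> [ch sh] oU dU sw XE phi psi k.
set D := chart_map phi @` _.
have DI p : D p -> [/\ chart_dom phi (chart_inv phi p), U (chart_inv phi p),
    chart_dom psi (h (chart_inv phi p)) & chart_map phi (chart_inv phi p) = p].
  by move=> [x [[dx Ux] dh] <-]; rewrite chart_mapK.
have oD : open D.
  rewrite /D -setIA; apply: chart_img_open_sub; apply: openI => //.
  by apply: open_comp; [move=> ? _; exact: ch|exact: chart_dom_open].
pose g := chart_map psi0 \o h \o chart_inv phi.
apply: (@Ck_eq _ _ _ _ _ (fun p => 'd (chart_map psi \o chart_inv psi0) (g p)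
    (w ((chart_map phi0 \o chart_inv phi) p)))) => //.
  move=> p /DI[dp Up dpsi pE]; have [d0 dh0] := dU _ Up.
  by rewrite XE // components_from_chart.
apply: (@Ck_diff_apply _ _ _ _ _ _
  (chart_map psi0 @` (chart_dom psi0 `&` chart_dom psi))) => //.
- move=> p /DI[dp Up dpsi pE]; have [d0 dh0] := dU _ Up.
  by exists (h (chart_inv phi p)).
- exact: chart_transition_smooth.
- apply: Ck_sub (sh phi psi0 k) => p /DI[dp Up dpsi pE].
  have [d0 dh0] := dU _ Up.
  by exists (chart_inv phi p).
- apply: (@Ck_comp _ _ _ _ _ _ (chart_map phi0 @` U)
    (chart_map phi0 \o chart_inv phi) w) => //.
  + by move=> p /DI[dp Up dpsi pE]; exists (chart_inv phi p).
  + apply: Ck_sub (@chart_transition_smooth _ _ M phi phi0 k).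
    move=> p /DI[dp Up dpsi pE]; have [d0 dh0] := dU _ Up.
    by exists (chart_inv phi p).
Qed.

Lemma smooth_map_id m (M : manifold R m) : smooth_map (fun x : M => x).
Proof.
split=> [x|phi psi]; first exact: cvg_id.
exact: chart_transition_smooth.
Qed.

(** Linear independence is stable under small perturbations: an injective
    linear map of finite-dimensional spaces is bounded below. *)
Lemma free_perturbation m r (v : 'I_r -> 'rV[R]_m) :
  (forall k : 'I_r -> R, \sum_j k j *: v j = 0 -> forall j, k j = 0) ->
  exists2 e : R, 0 < e & forall u : 'I_r -> 'rV[R]_m,
    (forall j, `|u j - v j| <= e) ->
    forall k : 'I_r -> R, \sum_j k j *: u j = 0 -> forall j, k j = 0.
Proof.
move=> fv; pose L : 'Hom('rV[R]_r, 'rV[R]_m) := linfun (mulmxr (\matrix_j v j)).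
have LE k : L k = \sum_j k 0 j *: v j.
  rewrite /L lfunE /= mulmx_sum_row.
  by apply: eq_bigr => j _; rewrite rowK.
have kerL : lker L == 0%VS.
  rewrite -subv0; apply/subvP => k; rewrite memv_ker LE => /eqP /fv k0.
  by rewrite memv0; apply/eqP/rowP => j; rewrite k0 mxE.
pose S : {linear 'rV[R]_m -> 'rV[R]_r} := (L^-1)%VF : _ -> _.
have [C C0 SC] := linear_lipschitz (@rV_linear_continuous _ _ _ S).
have Cr : 0 < 2 * C * r.+1%:R by rewrite !mulr_gt0.
(* [C] is a Lipschitz constant of a left inverse of [L]; the perturbation may
   change [L k] by at most half of the lower bound of its norm. *)
exists (2 * C * r.+1%:R)^-1 => [|u uv k ku]; first by rewrite invr_gt0.
pose K : 'rV[R]_r := \row_j k j.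
have KL : `|K| <= C * `|L K|.
  by rewrite -[in leLHS](lker0_lfunK kerL K); exact: SC.
have LK : `|L K| <= r%:R * (`|K| * (2 * C * r.+1%:R)^-1).
  have -> : L K = \sum_j k j *: (v j - u j).
    rewrite LE; under [RHS]eq_bigr do rewrite scalerBr.
    by rewrite sumrB ku subr0; apply: eq_bigr => j _; rewrite mxE.
  apply: le_trans (ler_norm_sum _ _ _) _.
  rewrite -[X in _ <= X%:R * _](card_ord r) -sumr_const mulr_suml.
  apply: ler_sum => j _; rewrite normrZ mul1r distrC; apply: ler_pM => //.
  have /(rV_norm_le _ (normr_ge0 _))/(_ j) := lexx `|K|.
  by rewrite mxE.
have K0 : K = 0.
  apply/eqP; rewrite -normr_le0.
  have H : `|K| <= C * (r%:R * (`|K| * (2 * C * r.+1%:R)^-1)).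
    by apply: le_trans KL _; rewrite ler_pM2l.
  have E : C * (r%:R * (`|K| * (2 * C * r.+1%:R)^-1)) =
      `|K| / 2 * (r%:R / r.+1%:R).
    by field; rewrite gt_eqF //= gt_eqF.
  have B : `|K| / 2 * (r%:R / r.+1%:R) <= `|K| / 2.
    rewrite ler_piMr ?divr_ge0 // ler_pdivrMr // mul1r ler_nat //.
  by rewrite E in H; have := le_trans H B; lra.
by move=> j; have /rowP/(_ j) := K0; rewrite !mxE.
Qed.

End Fields.

Section LocalFrames.
Variables (R : realType) (n r : nat) (G : lie_groupoid R n r).
Local Notation T_M := 'rV[R]_n.
Local Notation T_G := 'rV[R]_(r + n).
Local Notation A x := (subvs_of (algebroid (G := G) x)).

(** A constant frame in the chart at [x0]. *)
Lemma tangent_local_frame (x0 : obj G) : exists f : obj G -> n.-tuple T_M,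
  (forall x, chart_dom (chart_at x0) x -> basis_of fullv (f x)) /\
  (forall j, smooth_field_along (fun x : obj G => x) (chart_dom (chart_at x0))
     (fun x => tnth (f x) j)).
Proof.
have [e be] := frame_exists (dim_rV R n).
pose h x : 'Hom(T_M, T_M) := linfun (from_chart (chart_at x0) x).
have hE x v : h x v = from_chart (chart_at x0) x v.
  by rewrite /h /from_chart lfunE.
exists (fun x => map_tuple (h x) e); split=> [x dx|j].
  apply: injective_basis be; first exact: dim_rV.
  by move=> v; rewrite hE; exact: from_chart_inj.
apply: (@smooth_field_coord _ _ _ _ _ _ (chart_at x0) (chart_at x0) _
  (fun=> tnth e j)) => //.
- exact: smooth_map_id.
- exact: chart_dom_open.
- by move=> k; exact: Ck_cst.
- by move=> x _; rewrite tnth_map hE.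
Qed.


Lemma interior_local (x0 : obj G) (P : set (obj G)) : nbhs x0 P ->
  exists U : set (obj G), [/\ open U, U x0 & U `<=` P].
Proof.
move=> nP; exists (interior P); split; first exact: open_interior.
  exact: nP.
exact: interior_subset.
Qed.

(** A frame of the fibre of the algebroid at [x0] is extended by vectors of
    constant components along the units and then projected to the kernel of
    the tangent map of [src], along the tangent spaces of the units. The result
    stays a frame near [x0] by [free_perturbation]. *)
Lemma algebroid_local_frame (x0 : obj G) :
  exists (U : set (obj G)) (a : forall x, r.-tuple (A x)),
    [/\ open U, U x0, forall x, U x -> basis_of fullv (a x) &
      forall j, smooth_field_along (@gunit _ _ _ G) U
        (fun x => vsval (tnth (a x) j))].
Proof.
have [a0 ba0] := frame_exists (dim_algebroid (G := G) x0).
have su := @gunit_smooth _ _ _ G; have ss := (@src_submersion _ _ _ G).1.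
pose phi := chart_at x0; pose Phi := chart_at (gunit x0).
pose v j : T_G := vsval (tnth a0 j).
pose S := chart_map phi \o @src _ _ _ G \o chart_inv Phi.
pose Un := chart_map Phi \o @gunit _ _ _ G \o chart_inv phi.
pose w j p : T_G := v j - 'd Un p ('d S (Un p) (v j)).
pose U0 := chart_dom phi `&` (@gunit _ _ _ G) @^-1` chart_dom Phi.
have oU0 : open U0.
  apply: openI; first exact: chart_dom_open.
  apply: open_comp; last exact: chart_dom_open.
  by move=> z _; case: su => + _; apply.
have U0x0 : U0 x0 by split; exact: chart_at_dom.
have oD : open (chart_map phi @` U0).
  apply: chart_img_open_sub; apply: open_comp; last exact: chart_dom_open.
  by move=> z _; case: su => + _; apply.
have UnE x : U0 x -> Un (chart_map phi x) = chart_map Phi (gunit x).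
  by move=> [dx _]; rewrite /Un /= chart_mapK.
have sUn : smooth_on (chart_map phi @` U0) Un by case: su => _; apply.
pose D' := chart_map Phi @`
  (chart_dom Phi `&` (@src _ _ _ G) @^-1` chart_dom phi).
have sS : smooth_on D' S by case: ss => _; apply.
have UnD p : (chart_map phi @` U0) p -> D' (Un p).
  move=> [x Ux <-]; rewrite UnE //; exists (gunit x) => //.
  by case: Ux => dx du; split => //=; rewrite src_gunit.
have sw j : smooth_on (chart_map phi @` U0) (w j).
  move=> k; apply: CkD => //; first exact: Ck_cst.
  apply: (@Ck_eq _ _ _ _ _ (fun p => (-1 : R^o) *:
    ('d Un p ('d S (Un p) (v j))))) => //.
    by move=> p _; rewrite scaleN1r.
  apply: CkZ => //; first exact: Ck_cst.
  apply: (@Ck_diff_apply _ _ _ _ _ _ (chart_map phi @` U0) Un id) => //.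
    apply: (@Ck_lin _ _ _ _ _ idfun) => p; exact: cvg_id.
  apply: (@Ck_diff_apply _ _ _ _ _ _ D' S Un) => //; exact: Ck_cst.
have Sv0 j : 'd S (chart_map Phi (gunit x0)) (v j) = 0.
  have : tangent_map (@src _ _ _ G) (gunit x0) (v j) = 0.
    by apply/eqP; rewrite -memv_ker; exact: subvsP.
  by rewrite tangent_mapE /rep src_gunit.
have wx0 j : w j (chart_map phi x0) = v j.
  by rewrite /w UnE // Sv0 linear0 subr0.
(* [S] and [Un] express [src] and the units, and [S o Un = id]: so [w j] is the
   projection of [v j] to the kernel of ['d S]. *)
have Sw j x : U0 x ->
    'd S (chart_map Phi (gunit x)) (w j (chart_map phi x)) = 0.
  move=> Ux; have px : (chart_map phi @` U0) (chart_map phi x) by exists x.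
  have [dUn _] := sUn 1%N; have [dS _] := sS 1%N.
  have dSx := dS _ (UnD _ px); rewrite UnE // in dSx.
  have SUn u : 'd S (chart_map Phi (gunit x)) ('d Un (chart_map phi x) u) = u.
    have [_ idE] := is_diff_id (chart_map phi x).
    rewrite -[RHS]/(id u) -idE.
    apply: diff_chain (dUn _ px) (UnE _ Ux) dSx _.
    apply: filterS (open_nbhs_nbhs (conj oD px)) => q [z [dz duz] <-].
    by rewrite UnE // /S /= chart_mapK // src_gunit.
  by rewrite /w linearB UnE // SUn subrr.
have fv (k : 'I_r -> R) : \sum_j k j *: v j = 0 -> forall j, k j = 0.
  move=> k0; have /freeP fa0 := basis_free ba0; apply: fa0.
  apply: val_inj; rewrite /= linear_sum -[RHS]k0; apply: eq_bigr => j _.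
  by rewrite linearZ /v (tnth_nth 0).
have [e e0 ufree] := free_perturbation fv.
have nU : nbhs x0
    [set x | U0 x /\ forall j, `|w j (chart_map phi x) - v j| <= e].
  have nD : \forall p \near chart_map phi x0,
      forall j : 'I_r, `|w j p - v j| <= e.
    have nj j : \forall p \near chart_map phi x0, `|w j p - v j| <= e.
      have cw := sw j 0%N (chart_map phi x0) (ex_intro2 _ _ x0 U0x0 erefl).
      by rewrite -(wx0 j); move: cw => /cvgr_distC_le/(_ _ e0); apply.
    by near=> p => j; move: j; near: p; apply: filter_forall => j; exact: nj.
  have cphi := chart_map_continuous (chart_at_dom x0).
  have nx : \forall x \near x0,
      forall j : 'I_r, `|w j (chart_map phi x) - v j| <= e by exact: cphi nD.
  by apply: filterS (filterI (open_nbhs_nbhs (conj oU0 U0x0)) nx) => x [].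
have [U [oU Ux0 UP]] := interior_local nU.
pose W j x := from_chart Phi (gunit x) (w j (chart_map phi x)).
have WA j x : U x -> W j x \in algebroid x.
  move=> /UP[[dx du] _]; rewrite memv_ker /W; apply/eqP.
  rewrite (tangent_map_from_chart (psi := phi)) //= ?src_gunit //.
  have -> : 'd (chart_map phi \o @src _ _ _ G \o chart_inv Phi)
    (chart_map Phi (gunit x)) (w j (chart_map phi x)) = 0 by exact: Sw.
  exact: linear0.
exists U, (fun x => [tuple vsproj (algebroid x) (W j x) | j < r]); split => //.
- move=> x Ux; have [[dx du] wv] := UP _ Ux.
  rewrite basisEfree subvf size_tuple dim_algebroid leqnn !andbT.
  apply/freeP => k k0 j; apply: (ufree _ wv) j.
  apply: (from_chart_inj du).
  have -> : from_chart Phi (gunit x) (\sum_l k l *: w l (chart_map phi x)) =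
      \sum_l k l *: W l x.
    rewrite /from_chart linear_sum; apply: eq_bigr => l _.
    by rewrite linearZ.
  have := congr1 vsval k0; rewrite linear0 linear_sum; apply: etrans.
  apply: eq_bigr => l _.
  by rewrite linearZ nth_mktuple /= vsprojK // WA.
- move=> j; apply: (@smooth_field_coord _ _ _ _ _ _ phi Phi _ (w j)) => //.
  + by move=> x /UP[[dx du] _].
  + by move=> k; apply: Ck_sub (sw j k) => p [x /UP[Ux _] <-]; exists x.
  + by move=> x Ux; rewrite tnth_mktuple vsprojK // WA.
Unshelve. all: by end_near. Qed.

End LocalFrames.

(** * Invariant densities and the modular class *)

Section PositiveSections.
Variables (R : realType) (n r : nat) (G : lie_groupoid R n r).
Local Notation T_M := 'rV[R]_n.
Local Notation A x := (subvs_of (algebroid (G := G) x)).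
Implicit Types (x : obj G) (g : arr G).

Lemma algebroid_frame x : exists a : r.-tuple (A x), basis_of fullv a.
Proof. exact: frame_exists (dim_algebroid x). Qed.

Definition frame_A x : r.-tuple (A x) := projT1 (cid (algebroid_frame x)).

Lemma frame_A_basis x : basis_of fullv (frame_A x).
Proof. exact: projT2 (cid (algebroid_frame x)). Qed.

Definition frame_T : n.-tuple T_M := projT1 (cid (frame_exists (dim_rV R n))).

Lemma frame_T_basis : basis_of fullv frame_T.
Proof. exact: projT2 (cid (frame_exists (dim_rV R n))). Qed.

(** A frame at each point, chosen without any continuity: it serves to turn
    ratios of elements of a line into numbers. *)
Definition ref_frame x : r.-tuple 'Hom(A x, R^o) * n.-tuple T_M :=
  (dual_frame (frame_A x), frame_T).

Lemma positive_transverse_gt0 x (z : transverse_fiber x) (a : r.-tuple (A x))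
    (f : n.-tuple T_M) : positive_transverse z ->
  basis_of fullv a -> basis_of fullv f -> 0 < z (dual_frame a, f).
Proof.
move=> [eta [kappa [[_ e0] [_ k0] ->]]] ba bf; rewrite /pure_tensor /=.
by rewrite mulr_gt0 ?e0 ?k0 // dual_frame_basis.
Qed.

Lemma positive_transverse_line x (z : transverse_fiber x) :
  positive_transverse z -> transverse_line z.
Proof.
by move=> [eta [kappa [[de _] [dk _] ->]]]; exact: pure_in_tensor.
Qed.

Lemma positive_transverseZ x (c : R) (z : transverse_fiber x) : 0 < c ->
  positive_transverse z -> positive_transverse (fun p => c * z p).
Proof.
move=> c0 [eta [kappa [[de e0] pk ->]]].
exists (fun e => c * eta e), kappa; split => //.
  by split => [|e be]; [exact: densitiesZ|rewrite mulr_gt0 ?e0].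
by apply/funext => p; rewrite /pure_tensor mulrA.
Qed.

(** The factor between two elements of the line does not depend on the frame, so
    it can be computed in smooth frames or in the chosen one. *)
Lemma line_factor x (z z' : transverse_fiber x) (a : r.-tuple (A x))
    (f : n.-tuple T_M) : positive_transverse z -> transverse_line z' ->
  basis_of fullv a -> basis_of fullv f ->
  z' = fun p => z' (dual_frame a, f) / z (dual_frame a, f) * z p.
Proof.
move=> pz lz' ba bf; have bd := dual_frame_basis ba.
have z0 := positive_transverse_gt0 pz ba bf.
apply/funext => p; rewrite (tensor_densityE bd bf lz' p).
rewrite [in RHS](tensor_densityE bd bf (positive_transverse_line pz) p).
by rewrite [RHS]mulrA divfK // gt_eqF.
Qed.

Lemma line_ratioE x (z : transverse_fiber x) (k : R) :
  positive_transverse z -> line_ratio (fun p => k * z p) z = k.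
Proof.
move=> pz; rewrite /line_ratio; set S := [set c : R | _].
have := xgetPex 0 (ex_intro S k (erefl _)); move: (xget 0 S) => c.
move=> /(congr1 (fun f => f (ref_frame x))) /= /mulIf ->//.
by rewrite gt_eqF // positive_transverse_gt0 ?frame_A_basis ?frame_T_basis.
Qed.

(** So the ratio in the cocycle is positive. As [ln] is 0 on negative numbers, a
    vanishing cocycle would otherwise not imply invariance. *)
Lemma arrow_action_positive g (z : transverse_fiber (src g)) :
  positive_transverse z -> positive_transverse (arrow_action z).
Proof.
move=> [eta [kappa [[de e0] [dk k0] ->]]].
have bd := dual_frame_basis (frame_A_basis (tgt g)).
have bd' := dual_frame_basis (frame_A_basis (src g)).
have [k kpos ->//] := arrow_actionE (frame_A_basis (tgt g))
  (frame_A_basis (src g)) frame_T_basis.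
apply: positive_transverseZ.
  by rewrite !mulr_gt0 ?e0 ?k0 // frame_T_basis.
exists (vol (dual_frame (frame_A (tgt g)))), (vol frame_T).
split.
- exact: (vol_positive bd).
- exact: (vol_positive frame_T_basis).
- by [].
Qed.

Lemma arrow_actionZ g (c : R) (z : transverse_fiber (src g)) :
  positive_transverse z ->
  arrow_action (fun p => c * z p) = fun p => c * arrow_action z p.
Proof.
move=> [eta [kappa [[de _] [dk _] ->]]].
have [k _ kE] := arrow_actionE (frame_A_basis (tgt g))
  (frame_A_basis (src g)) frame_T_basis.
have E : (fun p => c * pure_tensor eta kappa p) =
    pure_tensor (fun e => c * eta e) kappa.
  by apply/funext => p; rewrite /pure_tensor mulrA.
apply: (etrans (congr1 (@arrow_action _ _ _ _ g) E)).
apply: (etrans (kE _ _ (densitiesZ c de) dk)).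
apply/funext => p; apply/esym.
apply: (etrans (congr1 (fun z => c * z p) (kE _ _ de dk))); ring.
Qed.

Lemma modular_cocycleE (sigma : forall x, transverse_fiber x) g (k : R) :
  positive_transverse (sigma (src g)) -> 
  sigma (tgt g) = (fun p => k * arrow_action (sigma (src g)) p) ->
  modular_cocycle sigma g = ln k.
Proof.
move=> ps sE; have pa := arrow_action_positive ps.
have E := etrans
  (congr1 (fun z => line_ratio z (arrow_action (sigma (src g)))) sE)
  (line_ratioE k pa).
rewrite /modular_cocycle; congr ln; exact: E.
Qed.

Lemma smooth_fun_scale (sigma : forall x, transverse_fiber x) (c : obj G -> R) :
  smooth_fun setT c -> transverse_section sigma ->
  transverse_section (fun x p => c x * sigma x p).
Proof.
move=> sc [ls ss]; split=> [x|U a f oU baf sa sf phi k].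
  have bd := dual_frame_basis (frame_A_basis x).
  have -> : (fun p => c x * sigma x p) = fun p =>
      (c x * sigma x (ref_frame x)) *
      (vol (dual_frame (frame_A x)) p.1 * vol frame_T p.2).
    apply/funext => p.
    by rewrite (tensor_densityE bd frame_T_basis (ls x) p) mulrA.
  exact: (tensor_densityZ _ (vol_positive bd).1 (vol_positive frame_T_basis).1).
have oD := @chart_img_open_sub _ _ _ phi _ oU.
apply: (@CkZ _ _ R^o _ _ (c \o chart_inv phi)) => //.
  by apply: Ck_sub (sc phi k) => p [x [dx _] <-]; exists x.
exact: ss oU baf sa sf phi k.
Qed.

(** The logarithm of the ratio of two positive sections is smooth, since near
    each point the ratio can be computed in smooth local frames. *)
Lemma smooth_ln_ratio (sigma sigma' : forall x, transverse_fiber x) :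
  positive_section sigma -> positive_section sigma' ->
  smooth_fun setT
    (fun x => ln (sigma' x (ref_frame x) / sigma x (ref_frame x))).
Proof.
move=> [[ls ss] ps] [[ls' ss'] ps'] phi k; apply: Ck_local => _ [x0 [dx0 _] <-].
have [U1 [a [oU1 U1x ba sa]]] := algebroid_local_frame x0.
have [f [bf sf]] := tangent_local_frame x0.
pose U := U1 `&` chart_dom (chart_at x0).
have oU : open U by apply: openI => //; exact: chart_dom_open.
have baf x : U x -> basis_of fullv (a x) /\ basis_of fullv (f x).
  by move=> [U1' dx]; split; [exact: ba|exact: bf].
have oD := @chart_img_open_sub _ _ _ phi _ oU.
have sfun (tau : forall x, transverse_fiber x) : transverse_section tau ->
    smooth_fun U (fun x => tau x (dual_frame (a x), f x)).
  move=> [_ st]; apply: st => // j.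
    move=> psi chi l; apply: Ck_sub (sa j psi chi l).
    by move=> _ [x [[dx [? _]] ?] <-]; exists x.
  move=> psi chi l; apply: Ck_sub (sf j psi chi l).
  by move=> _ [x [[dx [_ ?]] ?] <-]; exists x.
exists (chart_map phi @` (chart_dom phi `&` U)).
  by exists x0 => //; split => //; split => //; exact: chart_at_dom.
pose q (tau : forall x, transverse_fiber x) p : R^o :=
  tau (chart_inv phi p) (dual_frame (a (chart_inv phi p)), f (chart_inv phi p)).
have qpos tau p : (forall x, positive_transverse (tau x)) ->
    (chart_map phi @` (chart_dom phi `&` U)) p -> 0 < q tau p.
  move=> pt [x [dx Ux] <-]; rewrite /q chart_mapK //.
  by have [? ?] := baf _ Ux; exact: positive_transverse_gt0.
apply: (@Ck_eq _ _ _ _ _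
  (fun p => ln (q sigma' p *: (q sigma p)^-1) : R^o)) => //.
  move=> _ [x [dx Ux] <-] /=; rewrite /q chart_mapK //; congr ln.
  have [bax bfx] := baf _ Ux.
  have E := line_factor (ps x) (ls' x) bax bfx.
  rewrite [in RHS]E mulfK // gt_eqF //.
  by rewrite positive_transverse_gt0 ?frame_A_basis ?frame_T_basis.
apply: Ck_ln => //.
  by move=> p Dp; rewrite divr_gt0 // qpos.
apply: CkZ => //; first by apply: (sfun sigma').
apply: Ck_inv => //; first by move=> p Dp; rewrite gt_eqF // qpos.
by apply: (sfun sigma).
Qed.

Lemma smooth_funD (f h : obj G -> R) :
  smooth_fun setT f -> smooth_fun setT h ->
  smooth_fun setT (fun x => f x + h x).
Proof.
move=> sf sh phi k.
have oD := @chart_img_open_sub _ _ (obj G) phi _ openT.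
by apply: (@CkD _ _ R^o); [|exact: sf|exact: sh].
Qed.

Lemma smooth_funN (f : obj G -> R) :
  smooth_fun setT f -> smooth_fun setT (fun x => - f x).
Proof.
move=> sf phi k.
have oD := @chart_img_open_sub _ _ (obj G) phi _ openT.
apply: (@Ck_eq _ _ R^o _ _
  (fun p => (-1 : R^o) *: ((f \o chart_inv phi) p : R^o))) => //.
  by move=> p _; rewrite scaleN1r.
by apply: CkZ => //; [exact: Ck_cst|exact: sf].
Qed.

Lemma cohomology_class_coboundary (h : obj G -> R) : smooth_fun setT h ->
  cohomology_class G (coboundary h) = cohomology_class G (fun=> 0).
Proof.
move=> sh; apply/seteqP; split=> c [cc [f sf cE]]; split => //.
  exists (fun x => h x + f x); first exact: smooth_funD.
  by rewrite cE; apply/funext => g; rewrite !fctE /coboundary; ring.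
exists (fun x => f x + - h x).
  by apply: smooth_funD => //; exact: smooth_funN.
by rewrite cE; apply/funext => g; rewrite !fctE /coboundary; ring.
Qed.

(** The section from which the class is computed is a choice and need not be the
    one that is known to exist. *)
Lemma modular_classP :
  (exists sigma : forall x, transverse_fiber x, positive_section sigma) ->
  exists2 sigma : forall x, transverse_fiber x, positive_section sigma &
    modular_class G = cohomology_class G (modular_cocycle sigma).
Proof.
move=> [sigma psigma]; rewrite /modular_class; set S := [set K | _].
have S1 : S (cohomology_class G (modular_cocycle sigma)) by exists sigma.
exact: (xgetPex set0 (ex_intro S _ S1)).
Qed.

Lemma zero_class : cohomology_class G (fun=> 0) (fun=> 0).
Proof.
split; first by split=> [phi k|g h _]; [exact: Ck_cst|rewrite addr0].
exists (fun=> 0); first by move=> phi k; exact: Ck_cst.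
by apply/funext => g; rewrite fctE /coboundary subr0 addr0.
Qed.

End PositiveSections.

Theorem lemma3p2 (R : realType) (n r : nat) (G : lie_groupoid R n r) :
  (exists sigma : (forall x : obj G, transverse_fiber x),
     transverse_density sigma /\
     forall x, positive_transverse (sigma x)) <->
  modular_class G = cohomology_class G (fun=> 0).
Proof.
split.
- move=> [sigma [[ss inv] ps]].
  (* The class may have been computed from another positive section [sigma']. *)
  have [sigma' ps' ->] := modular_classP (ex_intro _ sigma (conj ss ps)).
  pose q x := sigma' x (ref_frame x) / sigma x (ref_frame x).
  have q0 x : 0 < q x.
    by rewrite divr_gt0 // positive_transverse_gt0 ?frame_A_basis
      ?frame_T_basis //; case: ps'.
  have qE x : sigma' x = fun p => q x * sigma x p.
    apply: line_factor; rewrite ?frame_A_basis ?frame_T_basis //.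
    by apply: positive_transverse_line; case: ps'.
  have sq := smooth_ln_ratio (conj ss ps) ps'.
  rewrite -(cohomology_class_coboundary (smooth_funN sq)).
  congr cohomology_class.
  apply/funext => g.
  rewrite (@modular_cocycleE _ _ _ _ _ _ (q (tgt g) / q (src g))).
  + by rewrite /coboundary ln_div ?posrE // opprK addrC.
  + by case: ps'.
  + rewrite [in LHS]qE [in RHS]qE arrow_actionZ // inv.
    by apply/funext => p; rewrite mulrA divfK // gt_eqF.
- move=> mod0.
  (* Without positive sections the class would be empty, but it contains 0. *)
  have ne : exists sigma : forall x : obj G, transverse_fiber x,
      positive_section sigma.
    apply: contrapT => nex; have := zero_class G; rewrite -mod0 /modular_class.
    by rewrite xgetPN // => K [sigma ps _]; apply: nex; exists sigma.
  have [sigma ps modE] := modular_classP ne.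
  have := zero_class G; rewrite -mod0 modE => -[_ [f sf fE]].
  have [ss pos] := ps.
  (* [c_sigma] is minus the coboundary of [f]: rescale [sigma] by [exp (- f)]. *)
  pose c x := expR (- f x).
  have sc : smooth_fun setT c.
    move=> phi k; have oD := @chart_img_open_sub _ _ (obj G) phi _ openT.
    by apply: Ck_exp => //; exact: smooth_funN sf phi k.
  exists (fun x p => c x * sigma x p); split; last first.
    by move=> x; apply: positive_transverseZ => //; exact: expR_gt0.
  split; first exact: smooth_fun_scale.
  move=> g; rewrite arrow_actionZ //.
  have pa := arrow_action_positive (pos (src g)).
  have lt := positive_transverse_line (pos (tgt g)).
  have bA := frame_A_basis (tgt g); have bT := frame_T_basis R n.
  have E := line_factor pa lt bA bT.
  set k := _ / _ in E.
  have k0 : 0 < k by rewrite divr_gt0 // positive_transverse_gt0.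
  have kE : ln k = f (tgt g) - f (src g).
    rewrite -(modular_cocycleE (pos (src g)) E).
    have := congr1 (fun c => c g) fE; rewrite fctE /coboundary => H.
    by apply/eqP; rewrite -subr_eq0 opprB -H.
  apply/funext => p; rewrite E mulrA; congr (_ * _).
  rewrite -[k]lnK ?posrE // kE /c -expRD; congr expR.
  by rewrite addKr.
Qed.
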